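(* Every finite simple graph on at least three vertices is reconstructible if and only if every $2$-connected graph $G$ such that $\gamma(G)=2$ or $\operatorname{diam}(G)=\operatorname{diam}(\overline{G})=2$ is reconstructible.
   Context: All graphs are finite, simple and undirected. $\gamma(G)$ denotes the domination number, $\operatorname{diam}(G)$ the diameter (infinite if $G$ is disconnected), and $\overline{G}$ the complement of $G$. For a vertex $v$, the card $G-v$ is the unlabeled graph obtained by deleting $v$; the deck $\mathscr{D}(G)$ is the multiset of all cards of $G$ up to isomorphism. $G$ is reconstructible if every graph $H$ with $\mathscr{D}(H)=\mathscr{D}(G)$ is isomorphic to $G$. A graph is $2$-connected if it has at least three vertices and remains connected after deleting any single vertex. *)

(* Defs.v *)
From mathcomp Require Import all_boot all_order.
Set Implicit Arguments. Unset Strict Implicit. Unset Printing Implicit Defensive.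

Record sgraph (n : nat) := SGraph {
  adj : rel 'I_n;
  adj_sym : symmetric adj;
  adj_irr : irreflexive adj }.

Definition iso n m (G : sgraph n) (H : sgraph m) : Prop :=
  exists f : 'I_n -> 'I_m, bijective f /\
    forall x y, adj H (f x) (f y) = adj G x y.

Lemma card_sym n (G : sgraph n.+1) (v : 'I_n.+1) :
  symmetric (fun x y : 'I_n => adj G (lift v x) (lift v y)).
Proof. by move=> x y; rewrite adj_sym. Qed.
Lemma card_irr n (G : sgraph n.+1) (v : 'I_n.+1) :
  irreflexive (fun x y : 'I_n => adj G (lift v x) (lift v y)).
Proof. by move=> x; rewrite adj_irr. Qed.
Definition card_del n (G : sgraph n.+1) (v : 'I_n.+1) : sgraph n :=
  SGraph (card_sym G v) (card_irr G v).

(* Equality of decks (multisets of cards up to isomorphism): a bijection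
   sigma between the vertex sets with G - v isomorphic to H - sigma v. *)
Definition same_deck n (G H : sgraph n.+1) : Prop :=
  exists sigma : 'I_n.+1 -> 'I_n.+1, bijective sigma /\
    forall v, iso (card_del G v) (card_del H (sigma v)).

(* Reconstructible: every graph with the same deck is isomorphic to G.
   (Graphs with a different number of vertices have decks with a different
   number of cards, so it suffices to quantify over graphs on n.+1 vertices.) *)
Definition reconstructible n (G : sgraph n.+1) : Prop :=
  forall H : sgraph n.+1, same_deck G H -> iso G H.

Lemma compl_sym n (G : sgraph n) :
  symmetric (fun x y : 'I_n => (x != y) && ~~ adj G x y).
Proof. by move=> x y; rewrite eq_sym adj_sym. Qed.
Lemma compl_irr n (G : sgraph n) :
  irreflexive (fun x y : 'I_n => (x != y) && ~~ adj G x y).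
Proof. by move=> x; rewrite eqxx. Qed.
Definition compl n (G : sgraph n) : sgraph n :=
  SGraph (@compl_sym n G) (@compl_irr n G).

Definition connected n (G : sgraph n) : Prop :=
  forall u v : 'I_n, connect (adj G) u v.

Definition two_connected n (G : sgraph n.+1) : Prop :=
  2 <= n /\ connected G /\ forall v, connected (card_del G v).

Definition dominating n (G : sgraph n) (D : {set 'I_n}) : bool :=
  [forall v, (v \in D) || [exists u in D, adj G u v]].
Definition domination_number n (G : sgraph n) : nat :=
  \big[minn/n]_(D : {set 'I_n} | dominating G D) #|D|.

(* Distance: least k such that there is a walk of length k from u to v;
   None (= infinity) if there is no walk at all (a shortest walk has length < n). *)
Definition walkb n (G : sgraph n) (k : nat) (u v : 'I_n) : bool :=
  [exists s : k.-tuple 'I_n, path (adj G) u s && (last u s == v)].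
Definition dist n (G : sgraph n) (u v : 'I_n) : option nat :=
  let k := find (fun k => walkb G k u v) (iota 0 n) in
  if k < n then Some k else None.

Definition diam n (G : sgraph n) : option nat :=
  if [forall u, forall v, dist G u v != None]
  then Some (\max_(u : 'I_n) \max_(v : 'I_n) odflt 0 (dist G u v))
  else None.

(* Main.v *)
Require Import Defs.
From mathcomp Require Import all_boot all_order all_fingroup zify.
Set Implicit Arguments. Unset Strict Implicit. Unset Printing Implicit Defensive.

(* If [e] or its complement is disconnected, [e] is reconstructible by Kelly's
   argument.  Otherwise, if both are 2-connected, either one of them has a
   dominating pair or both have diameter 2.  If only one of them is 2-connected,
   a cutvertex of the other provides a dominating pair.  If both have a
   cutvertex, then (up to complement) some vertex [d] misses a single vertex [c]
   and its deletion disconnects the graph, so the graph amounts to the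
   disconnected graph [A] obtained by deleting [d], rooted at [c]. Cards then
   give rooted cards of [A].  If no single deletion connects [A], a card in which
   the component of [c] survives determines the rooted component.  Otherwise
   [A] is a connected graph plus an isolated vertex [z]; joining a large
   independent set to everything except that one of its vertices misses [d]
   gives, without [z], a 2-connected graph with a dominating pair, whose deck is
   known by induction on the size of the independent set and which determines [d]. *)

(** A graph shares its reconstruction problem with its complement, so the real obstacle is a graph
    that has a cutvertex while its complement has one too: the assumption covers neither. There the
    card at [d] lacks only the knowledge of which vertex is [c], and isomorphisms of cards need not
    respect such a root. When [z] is pendant at [d], what is missing is the card at [z] rooted at
    [d]. An unrooted graph of the assumed kind must encode this root: one new vertex marks [d], and
    the others are so many that new vertices cannot be confused with old ones. The induction closes
    because deleting a new vertex leaves a smaller gadget of the same shape, and deleting [d] leaves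
    no root to respect. Subgraphs are vertex subsets of a fixed type and isomorphisms are total
    functions restricted to them, so deleting vertices needs no relabelling. *)

Definition simple (T : finType) (e : rel T) := symmetric e /\ irreflexive e.

Definition co (T : finType) (e : rel T) : rel T := fun x y => (x != y) && ~~ e x y.

(** * Isomorphisms between induced subgraphs *)

Definition isoOn (T T' : finType) (e : rel T) (e' : rel T')
    (A : {set T}) (B : {set T'}) (f : T -> T') : Prop :=
  [/\ {in A &, injective f}, f @: A = B
    & {in A &, forall x y, e' (f x) (f y) = e x y}].

Section IsoOn.
Variables (T T' : finType) (e : rel T) (e' : rel T').
Implicit Types (A : {set T}) (B : {set T'}).

Lemma isoOn_mem A B f x : isoOn e e' A B f -> x \in A -> f x \in B.
Proof. by case=> _ <- _ xA; apply: imset_f. Qed.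

Lemma isoOn_onto A B f y :
  isoOn e e' A B f -> y \in B -> exists2 x, x \in A & f x = y.
Proof. by case=> _ <- _ /imsetP[x xA ->]; exists x. Qed.

Lemma isoOn_card A B f : isoOn e e' A B f -> #|A| = #|B|.
Proof. by case=> fI <- _; rewrite card_in_imset. Qed.

Lemma isoOn_mk A B f :
    {in A &, injective f} -> (forall x, x \in A -> f x \in B) ->
    #|B| <= #|A| -> {in A &, forall x y, e' (f x) (f y) = e x y} ->
  isoOn e e' A B f.
Proof.
move=> fI fB cBA fe; split=> //; apply/eqP; rewrite eqEcard card_in_imset // cBA andbT.
by apply/subsetP=> _ /imsetP[x xA ->]; apply: fB.
Qed.

Lemma isoOn_sub A B A1 f :
  isoOn e e' A B f -> A1 \subset A -> isoOn e e' A1 (f @: A1) f.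
Proof. by case=> fI _ fe /subsetP sA; split=> // x y /sA ? /sA ?; [apply: fI|apply: fe]. Qed.

Lemma isoOn_del A B f x :
  isoOn e e' A B f -> x \in A -> isoOn e e' (A :\ x) (B :\ f x) f.
Proof.
move=> fiso xA; have := isoOn_sub fiso (subD1set A x).
suff -> : f @: (A :\ x) = B :\ f x by [].
have [fI fB _] := fiso; apply/setP=> y; apply/imsetP/setD1P.
  by case=> u /setD1P[ux uA] ->; rewrite (inj_in_eq fI) // (isoOn_mem fiso).
by case=> yfx /(isoOn_onto fiso)[u uA uy]; exists u => //; rewrite !inE uA andbT;
   apply: contra yfx => /eqP <-; rewrite uy.
Qed.

Lemma isoOn_eq A B f g : {in A, f =1 g} -> isoOn e e' A B f -> isoOn e e' A B g.
Proof.
move=> fg [fI <- fe]; split.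
- by move=> x y xA yA; rewrite -!fg //; apply: fI.
- by apply/esym; apply: eq_in_imset.
- by move=> x y xA yA; rewrite -!fg //; apply: fe.
Qed.

Lemma isoOn_co A B f : isoOn e e' A B f -> isoOn (co e) (co e') A B f.
Proof.
case=> fI fB fe; split=> // x y xA yA.
by rewrite /co (inj_in_eq fI) // fe.
Qed.

End IsoOn.

Lemma isoOn_inv (T T' : finType) (e : rel T) (e' : rel T') (x0 : T) A B f : isoOn e e' A B f ->
  exists g, [/\ isoOn e' e B A g, {in A, cancel f g} & {in B, cancel g f}].
Proof.
move=> fiso; have [fI fB fe] := fiso.
(* Off [B] the inverse takes the junk value [x0]; hence the demand for a point of [T]. *)
pose g y := odflt x0 [pick x in A | f x == y].
have fK : {in A, cancel f g}.
  move=> x xA; rewrite /g; case: pickP => [u /andP[uA /eqP]|/(_ x)] /=.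
    exact: fI.
  by rewrite xA eqxx.
have gK : {in B, cancel g f}.
  by move=> y /(isoOn_onto fiso)[x xA <-]; rewrite fK.
exists g; split=> //; apply: isoOn_mk.
- exact: can_in_inj gK.
- by move=> y /(isoOn_onto fiso)[x xA <-]; rewrite fK.
- by rewrite (isoOn_card fiso).
- move=> y1 y2 /(isoOn_onto fiso)[x1 xA1 <-] /(isoOn_onto fiso)[x2 xA2 <-].
  by rewrite !fK // fe.
Qed.

Section Glue.
Variables (T T' : finType) (e : rel T) (e' : rel T').
Hypotheses (eG : simple e) (eG' : simple e').
Implicit Types (A : {set T}) (B : {set T'}).

Lemma isoOn_glue A1 A2 B1 B2 f g :
    isoOn e e' A1 B1 f -> isoOn e e' A2 B2 g ->
    [disjoint A1 & A2] -> [disjoint B1 & B2] ->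
    (forall x y, x \in A1 -> y \in A2 -> e' (f x) (g y) = e x y) ->
  isoOn e e' (A1 :|: A2) (B1 :|: B2) (fun x => if x \in A1 then f x else g x).
Proof.
have [[eS _] [eS' _]] := (eG, eG').
move=> fiso giso dA dB feg.
have [fI fB fe] := fiso; have [gI gB ge] := giso.
have dfg x y : x \in A1 -> y \in A2 -> f x <> g y.
  move=> xA yA fgE; have := disjointFr dB (isoOn_mem fiso xA).
  by rewrite fgE (isoOn_mem giso yA).
apply: isoOn_mk.
- move=> x y; rewrite !inE.
  case xA: (x \in A1); case yA: (y \in A1) => //= H1 H2; first exact: fI.
  + by move/dfg; case.
  + by move/esym/dfg; case.
  + exact: gI.
- move=> x; rewrite !inE; case xA: (x \in A1) => /= H; first by rewrite (isoOn_mem fiso).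
  by rewrite (isoOn_mem giso) // orbT.
- rewrite [X in _ <= X]cardsU (_ : A1 :&: A2 = set0) ?cards0 ?subn0; last first.
    by apply/eqP; rewrite setI_eq0.
  by rewrite (isoOn_card fiso) (isoOn_card giso) cardsU leq_subr.
- move=> x y; rewrite !inE.
  case xA: (x \in A1); case yA: (y \in A1) => //= H1 H2; first exact: fe.
  + exact: feg.
  + by rewrite eS' eS; apply: feg.
  + exact: ge.
Qed.

Lemma isoOn_add A B f d d' :
    isoOn e e' A B f -> d \notin A -> d' \notin B ->
    (forall x, x \in A -> e' d' (f x) = e d x) ->
  isoOn e e' (d |: A) (d' |: B) (fun x => if x == d then d' else f x).
Proof.
move=> fiso dA dB df.
have d1 : isoOn e e' [set d] [set d'] (fun=> d').
  split; first by move=> x y /set1P-> /set1P->.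
    by rewrite imset_set1.
  by move=> x y /set1P-> /set1P->; rewrite eG.2 eG'.2.
have := isoOn_glue d1 fiso; rewrite !disjoints1 => /(_ dA dB).
move=> /(_ _) H; apply: isoOn_eq (H _) => [x _|x y /set1P->]; last exact: df.
by rewrite inE.
Qed.
End Glue.

Lemma isoOn_id (T : finType) (e : rel T) A : isoOn e e A A id.
Proof. by split=> //; rewrite imset_id. Qed.

Lemma isoOn_comp (T1 T2 T3 : finType) (e1 : rel T1) (e2 : rel T2) (e3 : rel T3)
    A B C f g :
  isoOn e1 e2 A B f -> isoOn e2 e3 B C g -> isoOn e1 e3 A C (g \o f).
Proof.
move=> fiso giso; have [fI fB fe] := fiso; have [gI gC ge] := giso; split.
- move=> x y xA yA /= /gI/fI; apply=> //; exact: (isoOn_mem fiso).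
- by rewrite imset_comp fB.
- by move=> x y xA yA /=; rewrite ge ?fe ?(isoOn_mem fiso).
Qed.

Lemma simple_co (T : finType) (e : rel T) : simple e -> simple (co e).
Proof. by case=> eS eI; split=> x; rewrite /co ?eqxx // => y; rewrite eS eq_sym. Qed.

Lemma coK (T : finType) (e : rel T) : simple e -> co (co e) =2 e.
Proof.
case=> eS eI x y; rewrite /co negb_and !negbK.
by case: eqVneq => [->|] //=; rewrite eI.
Qed.

(** * Cuts, connectedness and noncut vertices *)

Definition disc (T : finType) (e : rel T) (A : {set T}) : bool :=
  [exists S : {set T}, [&& S != set0, S \proper A &
     [forall x in S, forall y in A :\: S, ~~ e x y]]].

Section Disc.
Variables (T : finType) (e : rel T).
Implicit Types (A B K S : {set T}).

(** Only the trace of [S] on [A] matters, so a preimage can serve as a cut unchanged. Being a cut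
    condition, [disc] is false for the empty set and for singletons. *)
Lemma disc_intro A S x y : x \in A -> x \in S -> y \in A -> y \notin S ->
    (forall u v, u \in A -> u \in S -> v \in A -> v \notin S -> e u v = false) ->
  disc e A.
Proof.
move=> xA xS yA yS H; apply/existsP; exists (S :&: A); apply/and3P; split.
- by apply/set0Pn; exists x; rewrite inE xS.
- rewrite properE subsetIr /=; apply/negP=> /subsetP/(_ y yA).
  by rewrite inE (negPf yS).
- apply/forall_inP=> u /setIP[uS uA]; apply/forall_inP=> v.
  rewrite !inE => /andP[] vSA vA; rewrite H //.
  by move: vSA; rewrite vA andbT.
Qed.

Lemma disc_elim A : disc e A -> exists S x y, [/\ S \subset A, x \in S, y \in A :\: S
   & forall u v, u \in S -> v \in A -> v \notin S -> e u v = false].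
Proof.
case/existsP=> S /and3P[/set0Pn[x xS] /properP[sSA [y yA yS]] /forall_inP H].
exists S, x, y; split=> //; first by rewrite inE yS.
move=> u v /H /forall_inP/(_ v); rewrite inE => H1 vA vS.
by apply/negbTE; apply: H1; rewrite vS.
Qed.

Lemma conn_cut A S x y : ~~ disc e A -> x \in A -> x \in S -> y \in A -> y \notin S ->
  exists u v, [/\ u \in A, u \in S, v \in A, v \notin S & e u v].
Proof.
move=> nd xA xS yA yS.
case: (boolP [exists u in A :&: S, exists v in A :\: S, e u v]).
  case/exists_inP=> u /setIP[uA uS] /exists_inP[v /setDP[vA vS] uv].
  by exists u, v.
move=> nex; case/negP: nd; apply: (disc_intro xA xS yA yS) => u v uA uS vA vS.
apply/negP=> uv; case/negP: nex; apply/exists_inP; exists u; first by rewrite inE uA.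
by apply/exists_inP; exists v => //; rewrite inE vS.
Qed.

Lemma disc_at A x : symmetric e -> disc e A -> x \in A ->
  exists S y, [/\ S \subset A, x \in S, y \in A, y \notin S
   & forall u v, u \in S -> v \in A -> v \notin S -> e u v = false].
Proof.
move=> eS /disc_elim[S [a [b [sSA aS /setDP[bA bS] H]]]] xA.
case xS: (x \in S); first by exists S, b.
exists (A :\: S), a; split=> //.
- exact: subsetDl.
- by rewrite inE xS.
- exact: (subsetP sSA).
- by rewrite inE aS.
- move=> u v /setDP[uA uS] vA; rewrite inE vA andbT negbK => vS.
  by rewrite eS; apply: H.
Qed.

Lemma conn_attach A B b : b \in B -> B \subset A -> symmetric e -> ~~ disc e B ->
  (forall x, x \in A -> x \notin B -> exists2 y, y \in B & e x y) -> ~~ disc e A.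
Proof.
move=> bB /subsetP sBA eS ndB att; apply/negP=> dA.
have [S [y [/subsetP sSA bS yA yS H]]] := disc_at eS dA (sBA _ bB).
have BS v : v \in B -> v \in S.
  move=> vB; apply: contraT => vS.
  have [u [w [uB uS wB wS uw]]] := conn_cut ndB bB bS vB vS.
  by rewrite H ?(sBA w) in uw.
have yB : y \notin B by apply: contra yS; apply: BS.
have [w wB yw] := att _ yA yB.
by rewrite eS H ?(BS w) in yw.
Qed.

Lemma conn_hub A h : h \in A -> symmetric e ->
  (forall x, x \in A -> [\/ x = h, e h x | exists y, [/\ y \in A, e h y & e y x]]) ->
  ~~ disc e A.
Proof.
move=> hA eS H; apply/negP=> dA.
have [S [y [/subsetP sSA hS yA yS cl]]] := disc_at eS dA hA.
case: (H y yA) => [yh|hy|[w [wA hw wy]]].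
- by rewrite yh hS in yS.
- by rewrite cl in hy.
- case wS: (w \in S); first by rewrite cl in wy.
  by rewrite cl ?wS in hw.
Qed.

Lemma isolated_disc A z x : symmetric e -> z \in A -> x \in A -> x != z ->
  (forall y, y \in A -> e z y = false) -> disc e A.
Proof.
move=> eS zA xA xz zi; apply: (disc_intro zA (set11 z) xA) => [|u v uA /set1P-> vA _].
  by rewrite inE.
exact: zi.
Qed.

(** If the side of the cut containing [z] had a further vertex, the same cut would still separate
    [A :\ z]. *)
Lemma disc_del_isolated A z : symmetric e -> irreflexive e -> z \in A -> disc e A ->
  ~~ disc e (A :\ z) -> forall y, y \in A -> e z y = false.
Proof.
move=> eS eI zA dA nd y yA.
have [S [b [/subsetP sSA zS bA bS cl]]] := disc_at eS dA zA.
case: (boolP (y \in S)) => yS; last exact: cl.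
have [->|yz] := eqVneq y z; first exact: eI.
case/negP: nd; apply: (@disc_intro _ S y b) => //.
- by rewrite !inE yz.
- by rewrite !inE bA andbT; apply: contra bS => /eqP->.
- by move=> u v /setD1P[_ uA] uS /setD1P[_ vA] vS; apply: cl.
Qed.

(** Descent: if every vertex other than [x] were a cutvertex, a part [R] split off from [x] by [v]
    would contain a vertex splitting off a strictly smaller part. *)
Lemma noncut A x : symmetric e -> x \in A -> ~~ disc e A -> 1 < #|A| ->
  exists2 v, v \in A :\ x & ~~ disc e (A :\ v).
Proof.
move=> eS xA ndA cA.
case: (boolP [exists v in A :\ x, ~~ disc e (A :\ v)]).
  by case/exists_inP=> v vA nd; exists v.
move=> /exists_inPn allcut; exfalso.
pose P k := exists (v : T) (R : {set T}) (r : T), [/\ v \in A :\ x, R \subset A :\ v, r \in R, x \notin R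
   & #|R| = k /\ forall a b, a \in R -> b \in A :\ v -> b \notin R -> e a b = false].
have cut v : v \in A :\ x -> exists k, P k.
  move=> vA; have := allcut v vA; rewrite negbK => dv.
  have xAv : x \in A :\ v by rewrite inE xA andbT; case/setD1P: vA => vx _; rewrite inE eq_sym.
  have [S [y [sS xS yA yS cl]]] := disc_at eS dv xAv.
  exists #|(A :\ v) :\: S|, v, ((A :\ v) :\: S), y; split=> //.
  + exact: subsetDl.
  + by rewrite inE yS yA.
  + by rewrite inE xS.
  + split=> // a b /setDP[aA aS] bA; rewrite inE bA andbT negbK => bS.
    by rewrite eS cl.
have /card_gt1P[a [b [aA bA ab]]] := cA.
have [v0 v0A] : exists v, v \in A :\ x.
  have [ax|ax] := eqVneq a x; last by exists a; rewrite !inE ax.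
  by exists b; rewrite !inE bA andbT -ax eq_sym.
have Pn : forall k, ~ P k.
  elim/ltn_ind=> k IH [v [R [r [vA sR rR xR [cR cl]]]]].
  have rA : r \in A :\ x.
    have /setD1P[_ rA] := subsetP sR r rR.
    by rewrite !inE rA andbT; apply: contra xR => /eqP <-.
  have := allcut r rA; rewrite negbK => dr.
  have /setD1P[rx rA'] := rA; have /setD1P[vx vA'] := vA.
  have xAr : x \in A :\ r by rewrite !inE xA andbT eq_sym.
  have [S [y [/subsetP sS xS yA yS clS]]] := disc_at eS dr xAr.
  have [vS|vS] := boolP (v \in S).
    (* With [v] on the side of [x], the part cut off by [r] lies inside [R] and omits [r]: whatever
       of it lay outside [R] would be separated from [x] in [A] itself. *)
    pose R2 := (A :\ r) :\: S.
    have sR2 : R2 \subset R.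
      apply/subsetP=> w /setDP[/setD1P[wr wA] wS]; apply: contraT => wR.
      have wv : w != v by apply: contra wS => /eqP->.
      case/negP: ndA; apply: (@disc_intro _ (R2 :\: R) w x) => //.
      - by rewrite !inE wR wS wr wA.
      - by rewrite !inE xS andbF.
      move=> p q pA /setDP[/setDP[/setD1P[pr _] pS] pR] qA qn.
      have pv : p != v by apply: contra pS => /eqP->.
      have pAv : p \in A :\ v by rewrite !inE pv.
      have [qr|qr] := eqVneq q r; first by rewrite eS cl // qr.
      have [qS|qS] := boolP (q \in S).
        by rewrite eS clS // !inE pr.
      have qR : q \in R by move: qn; rewrite !inE qS qr qA /= andbT negbK.
      by rewrite eS cl.
    apply: (IH #|R2|).
      rewrite -cR; apply: proper_card; rewrite properE sR2 /=.
      by apply/negP=> /subsetP/(_ r rR); rewrite !inE eqxx andbF.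
    exists r, R2, y; split=> //.
    - exact: subsetDl.
    - by rewrite inE yS.
    - by rewrite inE xS.
    - split=> // p q /setDP[pA pS] qA; rewrite inE qA andbT negbK => qS.
      by rewrite eS clS.
  (* With [v] cut off from [x] by [r], the vertices of [S] outside [R] would have no neighbour
     beyond themselves, since [R] touches the rest of [A] only through [v]. *)
  case/negP: ndA; apply: (@disc_intro _ (S :\: R) x v) => //.
  - by rewrite inE xR.
  - by rewrite inE (negPf vS) andbF.
  move=> p q pA /setDP[pS pR] qA qn.
  have pv : p != v by apply: contra vS => /eqP <-.
  have pAv : p \in A :\ v by rewrite !inE pv.
  have [qr|qr] := eqVneq q r; first by rewrite eS cl // qr.
  have [qS|qS] := boolP (q \in S); last by apply: clS; rewrite ?inE ?qr.
  have qR : q \in R by move: qn; rewrite !inE qS andbT negbK.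
  by rewrite eS cl.
by have [k /Pn] := cut v0 v0A.
Qed.
End Disc.

Lemma isoOn_disc (T T' : finType) (e : rel T) (e' : rel T') A B f :
  isoOn e e' A B f -> disc e' B -> disc e A.
Proof.
move=> fiso /disc_elim[S [x [y [sS xS /setDP[yB yS] cl]]]].
have [a aA ax] := isoOn_onto fiso (subsetP sS x xS).
have [b bA bY] := isoOn_onto fiso yB.
apply: (@disc_intro _ _ _ (f @^-1: S) a b) => //; rewrite ?inE ?ax ?bY //.
move=> u v uA; rewrite !inE => uS vA vS.
by have [_ _ <-] := fiso => //; apply: cl => //; apply: (isoOn_mem fiso).
Qed.

(** * Components and cancellation *)

Definition closed_in (T : finType) (e : rel T) (A S : {set T}) : bool :=
  [forall u in S, forall v in A, e u v ==> (v \in S)].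

(* The component of [x] in the graph induced on [A]; junk unless [x] is in [A]. *)
Definition cls (T : finType) (e : rel T) (A : {set T}) (x : T) : {set T} :=
  \bigcap_(S : {set T} | [&& S \subset A, x \in S & closed_in e A S]) S.

Lemma closed_inP (T : finType) (e : rel T) (A S : {set T}) :
  reflect (forall u v, u \in S -> v \in A -> e u v -> v \in S) (closed_in e A S).
Proof.
apply: (iffP forall_inP) => [H u v uS vA uv|H u uS].
  by have /forall_inP/(_ v vA) := H u uS; rewrite uv.
by apply/forall_inP=> v vA; apply/implyP; apply: H uS vA.
Qed.

Section Cls.
Variables (T : finType) (e : rel T).
Hypothesis eS : symmetric e.
Implicit Types (A B K S : {set T}).

Lemma cls_sub A S x : S \subset A -> x \in S ->
  (forall u v, u \in S -> v \in A -> e u v -> v \in S) -> cls e A x \subset S.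
Proof. by move=> sSA xS cl; apply: bigcap_inf; rewrite sSA xS; apply/closed_inP. Qed.

Lemma cls_subA A x : x \in A -> cls e A x \subset A.
Proof. by move=> xA; apply: cls_sub. Qed.

Lemma cls_refl A x : x \in cls e A x.
Proof. by apply/bigcapP=> S /and3P[]. Qed.

Lemma cls_closed A x u v : u \in cls e A x -> v \in A -> e u v -> v \in cls e A x.
Proof.
move=> /bigcapP uS vA uv; apply/bigcapP=> S HS.
by have /and3P[_ _ /closed_inP cl] := HS; apply: cl uv => //; apply: uS.
Qed.

Lemma cls_eq A x y : x \in A -> y \in cls e A x -> cls e A y = cls e A x.
Proof.
move=> xA yx; have yA := subsetP (cls_subA xA) y yx.
have cl u v : u \in cls e A x -> v \in A -> e u v -> v \in cls e A x by apply: cls_closed.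
apply/eqP; rewrite eqEsubset cls_sub ?cls_subA //=.
suff xy : x \in cls e A y by apply: cls_sub; rewrite ?cls_subA // => u v; apply: cls_closed.
apply/bigcapP=> S /and3P[sSA yS /closed_inP clS]; apply: contraT => xS.
have /subsetP/(_ y yx) : cls e A x \subset A :\: S.
  apply: cls_sub; rewrite ?subsetDl // ?inE ?xS // => u v /setDP[uA uS] vA uv.
  by rewrite inE vA andbT; apply: contra uS => vS; apply: clS vS uA _; rewrite eS.
by rewrite inE yS.
Qed.

Lemma cls_conn A x : x \in A -> ~~ disc e (cls e A x).
Proof.
move=> xA; apply/negP=> d.
have [S [y [/subsetP sS xS yc yS cl]]] := disc_at eS d (cls_refl A x).
have /subsetP/(_ y yc) : cls e A x \subset S.
  apply: cls_sub => // [|u v uS vA uv].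
    by apply/subsetP=> u /sS; apply/subsetP; apply: cls_subA.
  have vc : v \in cls e A x by apply: cls_closed uv => //; apply: sS.
  by apply: contraT => vS; rewrite cl in uv.
by rewrite (negPf yS).
Qed.

Lemma cls_sup A K x : K \subset A -> x \in K -> ~~ disc e K -> K \subset cls e A x.
Proof.
move=> /subsetP sKA xK ndK; apply/subsetP=> y yK; apply: contraT => yc.
have [u [v [uK uc vK vc uv]]] := conn_cut ndK xK (cls_refl A x) yK yc.
by rewrite (cls_closed uc _ uv) ?sKA in vc.
Qed.

Lemma cls_out A x u v : x \in A -> u \in cls e A x -> v \in A -> v \notin cls e A x -> e u v = false.
Proof. by move=> xA uc vA vc; apply/negP=> uv; rewrite (cls_closed uc vA uv) in vc. Qed.

Lemma disc_cls A x : disc e A -> x \in A -> exists2 y, y \in A & y \notin cls e A x.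
Proof.
move=> d xA; have [S [y [sS xS yA yS cl]]] := disc_at eS d xA.
exists y => //; apply: contra yS; apply/subsetP; apply: cls_sub => // u v uS vA uv.
by apply: contraT => vS; rewrite cl in uv.
Qed.

Lemma cls_del A x v : x \in A -> v \notin cls e A x -> cls e (A :\ v) x = cls e A x.
Proof.
move=> xA vc.
have xv : x \in A :\ v by rewrite !inE xA andbT; apply: contra vc => /eqP <-; apply: cls_refl.
have sub : cls e A x \subset A :\ v by rewrite subsetD1 cls_subA.
apply/eqP; rewrite eqEsubset; apply/andP; split.
  apply: cls_sub; rewrite ?cls_refl // => a b ac /setD1P[_ bA]; exact: cls_closed.
by apply: cls_sup; rewrite ?cls_refl ?cls_conn.
Qed.

Lemma cls_mono A B x : A \subset B -> x \in A -> cls e A x \subset cls e B x.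
Proof.
move=> sAB xA; apply: cls_sup; rewrite ?cls_refl ?cls_conn //.
exact: subset_trans (cls_subA xA) sAB.
Qed.
End Cls.

Lemma isoOn_cls (T T' : finType) (e : rel T) (e' : rel T') A B f x :
  symmetric e' -> isoOn e e' A B f -> x \in A -> f @: cls e A x = cls e' B (f x).
Proof.
move=> eS' fiso xA; have [fI fB fe] := fiso.
have fxB := isoOn_mem fiso xA.
apply/eqP; rewrite eqEsubset; apply/andP; split.
  apply/subsetP=> _ /imsetP[y yc ->].
  have : y \in A :&: f @^-1: cls e' B (f x).
    move: y yc; apply/subsetP; apply: cls_sub.
    - exact: subsetIl.
    - by rewrite !inE xA cls_refl.
    move=> u v; rewrite !inE => /andP[uA uc] vA uv; rewrite vA /=.
    by apply: cls_closed uc _ _; rewrite ?fe // (isoOn_mem fiso).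
  by rewrite !inE => /andP[].
apply: cls_sub.
- by rewrite -fB imsetS ?cls_subA.
- by rewrite imset_f ?cls_refl.
move=> _ v /imsetP[u uc ->] /(isoOn_onto fiso)[w wA <-] uw.
have uA := subsetP (cls_subA e xA) u uc.
by rewrite imset_f // (cls_closed uc wA) // -fe.
Qed.

(* Cancellation of a connected component: if [phi] does not already match
   [K] with [K'], then it moves [K'] back to another copy of [K], and one
   detour through [psi] repairs it. *)
Lemma isoOn_cancel (T T' : finType) (e : rel T) (e' : rel T')
    (A : {set T}) (B : {set T'}) c c' (phi psi : T -> T') :
    simple e -> simple e' -> c \in A -> c' \in B ->
    isoOn e e' A B phi -> isoOn e e' (cls e A c) (cls e' B c') psi ->
  exists2 h, isoOn e e' A B h & {in cls e A c, h =1 psi}.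
Proof.
move=> eG eG' cA cB phiI psiI; have [[eS _] [eS' _]] := (eG, eG').
set K := cls e A c; set K' := cls e' B c'.
have [chi [chiI psiK chiK]] := isoOn_inv c psiI.
have KA x : x \in K -> x \in A by apply/subsetP; apply: cls_subA.
have K'B x : x \in K' -> x \in B by apply/subsetP; apply: cls_subA.
have [fI fB fe] := phiI; have [pI pB pe] := psiI; have [qI qB qe] := chiI.
have chiM y : y \in K' -> chi y \in K by apply: isoOn_mem chiI.
have psiM y : y \in K -> psi y \in K' by apply: isoOn_mem psiI.
have phiM y : y \in A -> phi y \in B by apply: isoOn_mem phiI.
have imK : phi @: K = cls e' B (phi c) by apply: isoOn_cls.
have imKP x : x \in A -> (x \in K) = (phi x \in phi @: K).
  move=> xA; apply/idP/imsetP => [xK|[y yK]]; first by exists x.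
  by move/fI => -> //; apply: KA.
have dich x y : x \in K -> phi x \in K' -> y \in A -> (phi y \in K') = (y \in K).
  move=> xK xK' yA; rewrite imKP // imK; suff -> : cls e' B (phi c) = K' by [].
  have : phi x \in cls e' B (phi c) by rewrite -imK imset_f.
  move/(cls_eq eS' (phiM _ cA)) <-; exact: cls_eq.
(* Once some vertex of [K] is sent into [K'], [phi] matches the two components exactly. So when an
   outsider lands in [K'], all of [K] lands outside, and the detour [phi (chi (phi x))] avoids
   [K']. *)
have noK' x y : x \in A -> x \notin K -> phi x \in K' -> y \in K -> phi y \notin K'.
  by move=> xA xK xK' yK; apply/negP=> yK'; rewrite (dich _ _ yK yK') ?(negPf xK) in xK'.
pose h x := if x \in K then psi x else if phi x \in K' then phi (chi (phi x)) else phi x.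
have outK x y : x \in K -> y \in A -> y \notin K -> e x y = false by apply: cls_out.
have outK' x y : x \in K' -> y \in B -> y \notin K' -> e' x y = false by apply: cls_out.
exists h; last by move=> x xK; rewrite /h xK.
have hM x : x \in A -> x \notin K -> h x \in B /\ h x \notin K'.
  move=> xA xK; rewrite /h (negPf xK); case: ifP => [xK'|/negbT xK']; last by rewrite phiM.
  have cK := chiM _ xK'; split; first by rewrite phiM ?KA.
  exact: noK' xK xK' cK.
have hK x : x \in K -> h x \in K' by move=> xK; rewrite /h xK psiM.
apply: isoOn_mk.
- move=> x y xA yA hxy.
  have [xK|xK] := boolP (x \in K); have [yK|yK] := boolP (y \in K).
  + by move: hxy; rewrite /h xK yK => /pI; apply.
  + by have [_] := hM y yA yK; rewrite -hxy hK.
  + by have [_] := hM x xA xK; rewrite hxy hK.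
  move: hxy; rewrite /h (negPf xK) (negPf yK).
  case: ifP => xK'; case: ifP => yK'.
  + move/(fI _ _ (KA _ (chiM _ xK')) (KA _ (chiM _ yK')))/(qI _ _ xK' yK').
    exact: fI.
  + move/(fI _ _ (KA _ (chiM _ xK')) yA) => Ey.
    by rewrite -Ey chiM in yK.
  + move/(fI _ _ xA (KA _ (chiM _ yK'))) => Ex.
    by rewrite Ex chiM in xK.
  + by move/fI; apply.
- move=> x xA; have [xK|/(hM x xA)[]//] := boolP (x \in K).
  by rewrite K'B ?hK.
- by rewrite (isoOn_card phiI).
- have nbr x y : x \in A -> x \notin K -> phi x \in K' -> y \in A -> y \notin K ->
      phi y \notin K' -> e' (phi (chi (phi x))) (phi y) = e x y.
    move=> xA xK xK' yA yK yK'; rewrite (fe _ _ (KA _ (chiM _ xK')) yA) outK ?chiM //.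
    by rewrite -fe // outK' ?phiM.
  move=> x y xA yA; have [xK|xK] := boolP (x \in K); have [yK|yK] := boolP (y \in K).
  + by rewrite /h xK yK pe.
  + have [hyB hyK] := hM y yA yK.
    by rewrite (outK _ _ xK yA yK) (outK' _ _ (hK _ xK) hyB hyK).
  + have [hxB hxK] := hM x xA xK.
    by rewrite eS' eS (outK _ _ yK xA xK) (outK' _ _ (hK _ yK) hxB hxK).
  rewrite /h (negPf xK) (negPf yK).
  case: ifP => xK'; case: ifP => yK'.
  + by rewrite (fe _ _ (KA _ (chiM _ xK')) (KA _ (chiM _ yK'))) (qe _ _ xK' yK') fe.
  + by apply: nbr; rewrite ?yK'.
  + by rewrite eS' eS; apply: nbr; rewrite ?xK'.
  + exact: fe.
Qed.

(** * Decks and degrees *)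

Definition deck_by (T : finType) (e e' : rel T) (s : T -> T) : Prop :=
  injective s /\ forall v, exists f, isoOn e e' [set~ v] [set~ s v] f.

Definition isoT (T : finType) (e e' : rel T) : Prop :=
  exists f, isoOn e e' setT setT f.

Definition deg (T : finType) (e : rel T) (v : T) : nat := #|[set y | e v y]|.

(** For a symmetric relation, twice the number of edges inside [A]. *)
Definition ecount (T : finType) (e : rel T) (A : {set T}) : nat :=
  \sum_(x in A) #|[set y in A | e x y]|.

Lemma isoOn_ecount (T : finType) (e e' : rel T) A B f :
  isoOn e e' A B f -> ecount e A = ecount e' B.
Proof.
move=> fiso; have [fI fB fe] := fiso.
rewrite /ecount -[in RHS]fB big_imset //=; apply: eq_bigr => x xA.
rewrite -(card_in_imset (f := f)); last first.
  by move=> u v /setIdP[uA _] /setIdP[vA _]; apply: fI.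
congr #|pred_of_set _|; apply/setP=> y; rewrite inE; apply/imsetP/andP.
  by case=> u /setIdP[uA xu] ->; rewrite imset_f // fe.
by case=> /imsetP[u uA ->]; rewrite fe // => xu; exists u => //; rewrite inE uA.
Qed.

Lemma ecount_del (T : finType) (e : rel T) v : simple e ->
  ecount e setT = ecount e [set~ v] + (deg e v).*2.
Proof.
case=> eS eI; rewrite /ecount (bigD1 v) ?inE //= -addnn addnA [LHS]addnC.
congr (_ + _); last by apply: eq_card => y; rewrite !inE.
rewrite (eq_bigl (fun x => x \in [set~ v])); last by move=> x; rewrite !inE.
rewrite (eq_bigr (fun x => #|[set y in [set~ v] | e x y]| + e x v)) => [|x _].
  rewrite big_split /=; congr (_ + _).
  rewrite /deg -sum1_card [RHS]big_mkcond [LHS]big_mkcond; apply: eq_bigr => x _ /=.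
  by rewrite !inE eS; case: eqVneq => [->|_]; rewrite ?eI //=; case: (e v x).
rewrite (cardsD1 v) !inE addnC /=; congr (_ + _).
by apply: eq_card => y; rewrite !inE.
Qed.

(** Every edge lies in all cards but the two at its ends, so the sum over the cards is [#|T| - 2]
    times the edge count. This factor is nonzero, and a degree is the number of edges lost on a
    card. *)
Lemma deck_deg (T : finType) (e e' : rel T) s v : simple e -> simple e' ->
  2 < #|T| -> deck_by e e' s -> deg e' (s v) = deg e v.
Proof.
move=> eG eG' cT [sI sd].
have Ev w : ecount e [set~ w] = ecount e' [set~ s w].
  by have [f] := sd w; apply: isoOn_ecount.
have tot (r : rel T) : simple r ->
    #|T| * ecount r setT = \sum_w ecount r [set~ w] + (ecount r setT).*2.
  move=> rG; rewrite -sum_nat_const (eq_bigr (fun w => ecount r [set~ w] + (deg r w).*2)).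
    rewrite big_split /=; congr (_ + _).
    rewrite /ecount -muln2 big_distrl /=; apply: eq_big => [x|x _]; first by rewrite in_setT.
    rewrite -muln2; congr (_ * _). by rewrite /deg; apply: eq_card => y; rewrite !inE.
  by move=> w _; apply: ecount_del.
have := tot e eG; have := tot e' eG'.
have -> : \sum_w ecount e' [set~ w] = \sum_w ecount e [set~ w].
  rewrite (reindex_inj sI); by apply: eq_bigr => w _; rewrite Ev.
move=> E1 E2; have EE : ecount e setT = ecount e' setT by nia.
have := ecount_del v eG; have := ecount_del (s v) eG'; rewrite Ev EE; lia.
Qed.

Lemma deck_sym (T : finType) (e e' : rel T) s : deck_by e e' s ->
  exists2 s', deck_by e' e s' & cancel s s' /\ cancel s' s.
Proof.
case=> sI sd; exists (invF sI); last by split; [apply: invF_f|apply: f_invF].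
split; first exact: (can_inj (f_invF sI)).
move=> v; have [f fi] := sd (invF sI v); rewrite f_invF in fi.
by have [g [gi _ _]] := isoOn_inv v fi; exists g.
Qed.

Lemma deck_co (T : finType) (e e' : rel T) s :
  deck_by e e' s -> deck_by (co e) (co e') s.
Proof. by case=> sI sd; split=> // v; have [f /isoOn_co fi] := sd v; exists f. Qed.

(** A connected graph has two noncut vertices, hence two connected cards. In a disconnected graph
    both deleted vertices would have to be isolated, but then the card at one of them still contains
    the other as an isolated vertex. *)
Lemma deck_disc (T : finType) (e e' : rel T) s : simple e -> simple e' ->
  2 < #|T| -> deck_by e e' s -> disc e setT -> disc e' setT.
Proof.
move=> [eS eI] [eS' eI'] cT [sI sd] d; apply: contraT => nd'.
have [x0 x0T] : exists x : T, x \in [set: T] by apply/card_gt0P; rewrite cardsT; lia.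
have cT' : 1 < #|[set: T]| by rewrite cardsT; lia.
have [u _ nu] := noncut eS' x0T nd' cT'.
have [w /setD1P[wu _] nw] := noncut eS' (in_setT u) nd' cT'.
have pull v : ~~ disc e' ([set: T] :\ s v) -> forall y, e v y = false.
  move=> nv; have nv' : ~~ disc e ([set: T] :\ v).
    have [f fi] := sd v; rewrite !setTD in nv *.
    have [g [gi _ _]] := isoOn_inv v fi.
    by apply: contra nv; apply: isoOn_disc gi.
  by move=> y; apply: (disc_del_isolated eS eI _ d nv').
pose a := invF sI u; pose b := invF sI w.
have ab : a != b by apply: contraNneq wu => ab; rewrite -(f_invF sI u) -(f_invF sI w) -/a ab.
have bi : forall y, e b y = false by apply: pull; rewrite f_invF.
have [f fi] := sd a; rewrite f_invF in fi.
have [g [gi _ _]] := isoOn_inv a fi.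
have [y yab] : exists y, y \in [set~ a] :\ b.
  apply/card_gt0P; have := cardsD1 b [set~ a]; have := cardsC1 a.
  by rewrite !inE eq_sym ab; lia.
case/negP: nu; rewrite setTD; apply: (isoOn_disc gi).
move: yab; rewrite !inE => /andP[yb ya].
by apply: (isolated_disc (z := b) (x := y)); rewrite // !inE // eq_sym.
Qed.

(** * Disconnected graphs *)

(** Boolean, so that the vertices whose component is a copy of [F] form a set and can be counted. *)
Definition siso (T T' : finType) (e : rel T) (e' : rel T') (A : {set T}) (B : {set T'}) : bool :=
  [exists f : {ffun T -> T'}, [&& dinjectiveb f (mem A), f @: A == B &
     [forall x in A, forall y in A, e' (f x) (f y) == e x y]]].

Lemma sisoP (T T' : finType) (e : rel T) (e' : rel T') A B :
  reflect (exists f, isoOn e e' A B f) (siso e e' A B).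
Proof.
apply: (iffP existsP) => [[f /and3P[/dinjectiveP fI /eqP fB /forall_inP fe]]|[f [fI fB fe]]].
  exists f; split=> // x y xA yA.
  by have /forall_inP/(_ y yA)/eqP := fe x xA.
exists (finfun f); apply/and3P; split.
- by apply/dinjectiveP=> x y xA yA; rewrite !ffunE; apply: fI.
- by apply/eqP; rewrite -fB; apply: eq_imset => x; rewrite ffunE.
- apply/forall_inP=> x xA; apply/forall_inP=> y yA.
  by rewrite !ffunE fe.
Qed.

Lemma siso_card (T T' : finType) (e : rel T) (e' : rel T') A B :
  siso e e' A B -> #|A| = #|B|.
Proof. by case/sisoP=> f; apply: isoOn_card. Qed.

Section Count.
Variables (T0 T : finType) (r0 : rel T0) (F : {set T0}).
Implicit Types (A B : {set T}) (r : rel T).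

(** It counts vertices, not components: each copy of [F] contributes [#|F|], and double counting
    over deleted vertices needs no division. *)
Definition ncls r A : nat := #|[set x in A | siso r0 r F (cls r A x)]|.

Lemma ncls_iso (x0 : T) (r r' : rel T) A B f : symmetric r -> symmetric r' ->
  isoOn r r' A B f -> ncls r A = ncls r' B.
Proof.
move=> rS rS' fiso; have [fI fB fe] := fiso.
have [g [gi fK gK]] := isoOn_inv x0 fiso.
rewrite /ncls -(card_in_imset (f := f)); last first.
  by move=> u v /setIdP[uA _] /setIdP[vA _]; apply: fI.
have key x : x \in A -> siso r0 r' F (cls r' B (f x)) = siso r0 r F (cls r A x).
  move=> xA; rewrite -(isoOn_cls rS' fiso xA).
  have fc := isoOn_sub fiso (cls_subA r xA).
  have [g' [gc _ _]] := isoOn_inv x0 fc.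
  apply/sisoP/sisoP=> -[h hi].
    by exists (g' \o h); apply: isoOn_comp hi gc.
  by exists (f \o h); apply: isoOn_comp hi fc.
congr #|pred_of_set _|; apply/setP=> y; rewrite [RHS]inE; apply/imsetP/andP.
  by case=> x /setIdP[xA Fx] ->; rewrite (isoOn_mem fiso) ?key.
case=> /(isoOn_onto fiso)[x xA <-]; rewrite key // => Fx.
by exists x => //; rewrite inE xA.
Qed.

(** Deleting [v] breaks only its own component, and every piece left of that is smaller than [F], so
    no new copy can appear. *)
Lemma ncls_del_max r A v : symmetric r -> v \in A ->
    (forall x, x \in A -> #|cls r A x| <= #|F|) ->
  ncls r A = ncls r (A :\ v) + (if siso r0 r F (cls r A v) then #|F| else 0).
Proof.
move=> rS vA mx; rewrite /ncls.
set P := [set x in A | _]; set Q := [set x in A :\ v | _].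
have vxE x : x \in A -> (v \in cls r A x) = (x \in cls r A v).
  by move=> xA; apply/idP/idP => /(cls_eq rS _) -> //; rewrite cls_refl.
have QE : Q = P :\: cls r A v.
  apply/setP=> x; rewrite !inE; have [->|xv] := eqVneq x v.
    by rewrite cls_refl.
  have [xA|] //= := boolP (x \in A); last by rewrite andbF.
  have [xc|xc] := boolP (x \in cls r A v); last by rewrite cls_del ?vxE.
  apply/negbTE; apply/negP=> /siso_card cF.
  have xA' : x \in A :\ v by rewrite !inE xv.
  have sub : cls r (A :\ v) x \subset cls r A v :\ v.
    rewrite subsetD1; apply/andP; split.
      rewrite -(cls_eq rS vA xc); apply: cls_mono => //; exact: subD1set.
    by apply/negP=> /(subsetP (cls_subA r xA')); rewrite !inE eqxx.
  have := subset_leq_card sub; have := mx v vA.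
  by rewrite cF (cardsD1 v (cls r A v)) cls_refl; lia.
have := cardsID (cls r A v) P; rewrite -QE.
case: ifP => Fv.
  have -> : P :&: cls r A v = cls r A v.
    apply/setIidPr/subsetP=> x xc; have xA := subsetP (cls_subA r vA) x xc.
    by rewrite inE xA (cls_eq rS vA).
  by rewrite (siso_card Fv); lia.
have -> : P :&: cls r A v = set0.
  apply/setP=> x; rewrite !inE; apply/negP=> /andP[/andP[xA Fx] xc].
  by rewrite (cls_eq rS vA xc) Fv in Fx.
by rewrite cards0; lia.
Qed.

(** The component of [v] is one vertex too big to be a copy, so no copy is lost. What remains of it
    has [#|F|] vertices and yields a copy only as a whole. *)
Lemma ncls_del_pred r A v : symmetric r -> v \in A -> symmetric r0 ->
    ~~ disc r0 F -> #|cls r A v| = #|F|.+1 ->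
  ncls r (A :\ v) = ncls r A + (if siso r0 r F (cls r A v :\ v) then #|F| else 0).
Proof.
move=> rS vA rS0 ndF cv; rewrite /ncls.
set Q := [set x in A | _]; set P := [set x in A :\ v | _].
have vxE x : x \in A -> (v \in cls r A x) = (x \in cls r A v).
  by move=> xA; apply/idP/idP => /(cls_eq rS _) -> //; rewrite cls_refl.
have cv' : #|cls r A v :\ v| = #|F|.
  by have := cardsD1 v (cls r A v); rewrite cls_refl cv; lia.
have QE : Q = P :\: cls r A v.
  apply/setP=> x; rewrite !inE; have [->|xv] := eqVneq x v.
    by rewrite cls_refl vA; apply/negbTE/negP=> /siso_card; lia.
  have [xA|] //= := boolP (x \in A); last by rewrite andbF.
  have [xc|xc] := boolP (x \in cls r A v); last by rewrite cls_del ?vxE.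
  by rewrite (cls_eq rS vA xc); apply/negbTE/negP=> /siso_card; lia.
have sub x : x \in A :\ v -> x \in cls r A v -> cls r (A :\ v) x \subset cls r A v :\ v.
  move=> xA' xc; rewrite subsetD1; apply/andP; split.
    rewrite -(cls_eq rS vA xc); apply: cls_mono => //; exact: subD1set.
  by apply/negP=> /(subsetP (cls_subA r xA')); rewrite !inE eqxx.
have := cardsID (cls r A v) P; rewrite -QE.
case: ifP => Fv.
  have -> : P :&: cls r A v = cls r A v :\ v.
    apply/setP=> x; rewrite in_setI in_setD1.
    have [->|xv] /= := eqVneq x v; first by rewrite !inE eqxx.
    have [xc|] := boolP (x \in cls r A v); last by rewrite andbF.
    rewrite andbT inE; have xA' : x \in A :\ v.
      by rewrite !inE xv (subsetP (cls_subA r vA)).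
    rewrite xA' /=; suff -> : cls r (A :\ v) x = cls r A v :\ v by [].
    apply/eqP; rewrite eqEsubset sub //=; apply: cls_sup => //.
    - by apply: setSD; apply: cls_subA.
    - by rewrite !inE xv.
    - have /sisoP[f fi] := Fv.
      by apply: contra ndF; apply: isoOn_disc fi.
  by rewrite cv'; lia.
have -> : P :&: cls r A v = set0.
  apply/setP=> x; rewrite !inE; apply/negP=> /andP[/andP[/andP[xv xA] Fx] xc].
  have xA' : x \in A :\ v by rewrite !inE xv.
  have E : cls r (A :\ v) x = cls r A v :\ v.
    by apply/eqP; rewrite eqEcard sub //= cv' -(siso_card Fx).
  by rewrite -E Fx in Fv.
by rewrite cards0; lia.
Qed.
End Count.

(* Kelly's argument: among the cards deleting a vertex of a copy of a largest
   component [F], those with the most components isomorphic to [F :\ v0]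
   (connected) come from deleting a vertex of that kind; cancel [F :\ v0]. *)
Lemma disc_recon (T : finType) (e e' : rel T) s : simple e -> simple e' ->
  2 < #|T| -> deck_by e e' s -> disc e setT -> isoT e e'.
Proof.
move=> eG eG' cT sd d.
have d' := deck_disc eG eG' cT sd d.
have /card_gt0P[t0 _] : 0 < #|T| by lia.
(* The graphs are exchanged if necessary, so that a component of [e] is largest among those of
   both. *)
wlog mx : e e' s eG eG' sd d d' / exists x0, forall y,
    #|cls e setT y| <= #|cls e setT x0| /\ #|cls e' setT y| <= #|cls e setT x0|.
  move=> W.
  pose a := [arg max_(x > t0) #|cls e setT x|]; pose a' := [arg max_(x > t0) #|cls e' setT x|].
  have aM y : #|cls e setT y| <= #|cls e setT a| by rewrite /a; case: arg_maxnP => // x _; apply.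
  have aM' y : #|cls e' setT y| <= #|cls e' setT a'| by rewrite /a'; case: arg_maxnP => // x _; apply.
  have [le|/ltnW le] := leqP #|cls e' setT a'| #|cls e setT a|.
    apply: (W e e' s) => //; exists a => y; split=> //; exact: leq_trans (aM' y) le.
  have [s' sd' _] := deck_sym sd.
  have [|f fi] := W e' e s' eG' eG sd' d' d.
    by exists a' => y; split=> //; exact: leq_trans (aM y) le.
  by have [g [gi _ _]] := isoOn_inv t0 fi; exists g.
have [x0 mxx] := mx; set F := cls e setT x0 in mxx.
have [[eS eI] [eS' eI']] := (eG, eG').
have [sI sc] := sd.
have delT (r : rel T) v : ncls e F r [set~ v] = ncls e F r (setT :\ v) by rewrite setTD.
have N v := @ncls_del_max _ _ e F e setT v eS (in_setT v) (fun x _ => (mxx x).1).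
have N' v := @ncls_del_max _ _ e F e' setT v eS' (in_setT v) (fun x _ => (mxx x).2).
have cards (H : {set T}) v : ncls e H e (setT :\ v) = ncls e H e' (setT :\ s v).
  by rewrite !setTD; have [f] := sc v; apply: ncls_iso.
have F0 : 0 < #|F| by apply/card_gt0P; exists x0; apply: cls_refl.
have FT : #|F| < #|T|.
  have [y _ yF] := disc_cls eS d (in_setT x0).
  by rewrite -cardsT; apply: proper_card; apply/properP; split; [apply: subsetT|exists y].
pose S := \sum_v ncls e F e (setT :\ v).
(* The sum on the right is given by the deck, and [#|F| < #|T|], so the number of vertices in copies
   of [F] can be solved for. *)
have avg (r : rel T) : (forall v, ncls e F r setT = ncls e F r (setT :\ v)
      + (if siso e r F (cls r setT v) then #|F| else 0)) ->
    #|T| * ncls e F r setT = \sum_v ncls e F r (setT :\ v) + ncls e F r setT * #|F|.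
  move=> Nr; rewrite -sum_nat_const (eq_bigr _ (fun v _ => Nr v)) big_split /=.
  congr (_ + _); rewrite -big_mkcond sum_nat_const; congr (_ * _).
  by apply: eq_card => x; rewrite !inE.
have nE : ncls e F e setT = ncls e F e' setT.
  have A1 := avg e N; have A2 := avg e' N'.
  rewrite (reindex_inj sI) /= (eq_bigr _ (fun v _ => esym (cards F v))) in A2.
  apply/eqP; rewrite -(eqn_pmul2l (m := #|T| - #|F|)) ?subn_gt0 // !mulnBl A1 A2.
  by rewrite ![_ * #|F|]mulnC !addnK.
have cpy v : siso e e F (cls e setT v) = siso e e' F (cls e' setT (s v)).
  by have := N v; have := N' (s v); rewrite -nE -cards; do 2 case: (siso _ _ _ _) => //=; lia.
(* If the largest components are single vertices, neither graph has an edge. *)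
have [M1|M1] := leqP #|F| 1.
  have no (r : rel T) : (forall y, #|cls r setT y| <= #|F|) -> irreflexive r ->
      forall x y, r x y = false.
    move=> mxr rI x y; apply/negP=> xy.
    have : 1 < #|cls r setT x|.
      apply/card_gt1P; exists x, y; rewrite cls_refl (cls_closed (cls_refl r _ x) _ xy) //.
      by split=> //; apply: contraTneq xy => ->; rewrite rI.
    by have := mxr x; lia.
  exists id; split=> [//||x y _ _]; first by rewrite imset_id.
  by rewrite !no // => w; have [] := mxx w.
have [v0 /setD1P[_ v0F] ndD] := noncut eS (cls_refl e setT x0) (cls_conn eS (in_setT x0)) M1.
rewrite -/F in v0F ndD.
set D := F :\ v0 in ndD.
have cD : #|F| = #|D|.+1 by rewrite (cardsD1 v0 F) v0F.
have Fv0 : cls e setT v0 = F by apply: cls_eq.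
have siF : siso e e F F by apply/sisoP; exists id; apply: isoOn_id.
have siD : siso e e D D by apply/sisoP; exists id; apply: isoOn_id.
have P (r : rel T) v : symmetric r -> siso e r F (cls r setT v) ->
    ncls e D r (setT :\ v) = ncls e D r setT + (if siso e r D (cls r setT v :\ v) then #|D| else 0).
  by move=> rS /siso_card cv; apply: ncls_del_pred => //; rewrite -cv.
set u0 := s v0; set C := cls e' setT u0.
have FC : siso e e' F C by rewrite -cpy Fv0.
have [psi psiI] := sisoP _ _ _ _ FC.
have DC : siso e e' D (C :\ u0).
  have P0 := P e v0 eS; rewrite Fv0 siF siD in P0; have {}P0 := P0 isT.
  have P1 := P e' u0 eS' FC.
  (* The totals for [D] in the two graphs are not known to agree. Deleting [w], the counterpart of
     [v0] in [C], surely gains a copy of [D]; if nothing were gained at [u0], the cards at [u0] and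
     at [w] would force incompatible totals. *)
  pose w := psi v0; have wC : w \in C by apply: isoOn_mem psiI v0F.
  have Cw : cls e' setT w = C by apply: cls_eq.
  have P2 := P e' w eS'; rewrite Cw FC in P2; have {P2} := P2 isT.
  have -> : siso e e' D (C :\ w) by apply/sisoP; exists psi; apply: isoOn_del.
  have w's : s (invF sI w) = w by apply: f_invF.
  have P3 := P e (invF sI w) eS; rewrite cpy w's Cw FC in P3; have {P3} := P3 isT.
  have := cards D v0; rewrite -/u0; have := cards D (invF sI w); rewrite w's.
  by move: P1 P0; rewrite -/C; do 2 case: ifP => _; lia.
have [chi chiI] := sisoP _ _ _ _ DC.
have [f fi] := sc v0; rewrite -/u0 in fi.
have [y yD] : exists y, y \in D by apply/card_gt0P; lia.
have yv0 : y \in [set~ v0] by move: yD; rewrite !inE => /andP[].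
have chiy : chi y \in C :\ u0 by apply: isoOn_mem chiI yD.
have chiy' : chi y \in [set~ u0] by move: chiy; rewrite !inE => /andP[].
have clsy : cls e [set~ v0] y = D.
  apply/eqP; rewrite eqEsubset; apply/andP; split.
    rewrite subsetD1; apply/andP; split.
      have yF : y \in F by move: yD; rewrite !inE => /andP[].
      by rewrite /F -(cls_eq eS (in_setT x0) yF); apply: cls_mono; rewrite ?subsetT.
    by apply/negP=> /(subsetP (cls_subA e yv0)); rewrite !inE eqxx.
  by apply: cls_sup => //; rewrite /D setDE subsetIr.
have clsy' : cls e' [set~ u0] (chi y) = C :\ u0.
  apply/eqP; rewrite eqEsubset; apply/andP; split.
    rewrite subsetD1; apply/andP; split.
      have yF : chi y \in C by move: chiy; rewrite !inE => /andP[].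
      by rewrite /C -(cls_eq eS' (in_setT u0) yF); apply: cls_mono; rewrite ?subsetT.
    by apply/negP=> /(subsetP (cls_subA e' chiy')); rewrite !inE eqxx.
  apply: cls_sup => //; first by rewrite setDE subsetIr.
  have [g [gi _ _]] := isoOn_inv t0 chiI.
  by apply: contra ndD; apply: isoOn_disc chiI.
have [h hi hchi] : exists2 h, isoOn e e' [set~ v0] [set~ u0] h & {in D, h =1 chi}.
  have := isoOn_cancel (psi := chi) eG eG' yv0 chiy' fi.
  by rewrite clsy clsy'; apply.
have [hI _ he] := hi.
have ho : isoOn e e' (~: F) (~: C) h.
  have nv x : x \in ~: F -> x \in [set~ v0].
    by rewrite !inE; apply: contra => /eqP->.
  apply: isoOn_mk.
  - by move=> a b /nv aA /nv bA; apply: hI.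
  - move=> x xF; rewrite inE; apply/negP=> hC.
    have : h x \in C :\ u0.
      by rewrite inE hC andbT; have := isoOn_mem hi (nv _ xF); rewrite !inE.
    case/(isoOn_onto chiI)=> w wD; rewrite -hchi // => /hI E.
    have wv : w \in [set~ v0] by move: wD; rewrite !inE => /andP[].
    by move: (xF); rewrite -(E wv (nv _ xF)) inE; case/setD1P: wD => _ ->.
  - by have := cardsC F; have := cardsC C; rewrite -(siso_card FC); lia.
  - by move=> a b /nv aA /nv bA; apply: he.
exists (fun x => if x \in F then psi x else h x).
have := isoOn_glue eG eG' psiI ho; rewrite !setUCr !disjoints_subset !setCK.
apply=> // a b aF; rewrite inE => bF.
rewrite (cls_out (in_setT x0) aF (in_setT b) bF).
have pC := isoOn_mem psiI aF.
apply: cls_out pC (in_setT _) _ => //; have := isoOn_mem ho (x := b).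
by rewrite !inE; apply.
Qed.

(** * Cutvertices missing a single vertex *)

Lemma isoOn_twins (T : finType) (e : rel T) (X : {set T}) a b : simple e ->
    a \in X -> b \in X ->
    (forall u, u \in X -> u != a -> u != b -> e a u = e b u) ->
  isoOn e e X X (tperm a b).
Proof.
move=> [eS eI] aX bX ab; apply: isoOn_mk => //.
- by move=> x y _ _ /perm_inj.
- by move=> x xX; case: tpermP.
move=> x y xX yX; case: tpermP => [->|->|/eqP xa /eqP xb];
  case: tpermP => [->|->|/eqP ya /eqP yb]; rewrite ?eI //.
- by rewrite ab.
- by rewrite ab.
- by rewrite eS [RHS]eS ab.
- by rewrite eS [RHS]eS ab.
Qed.

Definition misses_only (T : finType) (e : rel T) (X : {set T}) (d c : T) : Prop :=
  [/\ d \in X, c \in X, c != d & forall u, u \in X -> e d u = (u != d) && (u != c)].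

(** Every other vertex of [X] is adjacent to both [d] and [x] and to neither [c] nor [w], so
    swapping both pairs at once only has to be checked on the four vertices. *)
Lemma isoOn_double_swap (T : finType) (e : rel T) (X : {set T}) d x c w : simple e ->
    misses_only e X d c -> misses_only e X x w -> d != x -> c != w ->
    (forall u, u \in X -> e c u = (u == x)) -> (forall u, u \in X -> e w u = (u == d)) ->
  exists2 t, isoOn e e X X t & [/\ t d = x, t x = d, t c = w & t w = c].
Proof.
move=> [eS eI] [dX cX cd Hd] [xX wX wx Hx] dx cw Hc Hw.
have cx : c != x by rewrite -Hc // eI.
have wd : w != d by rewrite -Hw // eI.
pose t u := if u == d then x else if u == x then d else if u == c then w else
  if u == w then c else u.
have td : t d = x by rewrite /t eqxx.
have tx : t x = d by rewrite /t eqxx eq_sym (negPf dx).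
have tc : t c = w by rewrite /t eqxx (negPf cx) (negPf cd).
have tw : t w = c by rewrite /t eqxx (negPf wx) (negPf wd) eq_sym (negPf cw).
have tK : involutive t.
  move=> u; rewrite {2}/t.
  case: (eqVneq u d) => [->|ud]; first by [].
  case: (eqVneq u x) => [->|ux]; first by [].
  case: (eqVneq u c) => [->|uc]; first by [].
  case: (eqVneq u w) => [->|uw]; first by [].
  by rewrite /t (negPf ud) (negPf ux) (negPf uc) (negPf uw).
have tE u v : (t u == v) = (u == t v) by apply/eqP/eqP => [<-|->].
have tX u : u \in X -> t u \in X.
  by move=> uX; rewrite /t; do 4 (case: ifP => // _).
have row u v : u \in [:: d; x; c; w] -> v \in X -> e (t u) (t v) = e u v.
  rewrite !inE => + vX; case/or4P => /eqP->.
  - by rewrite td Hx ?tX // Hd // !tE tx tw.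
  - by rewrite tx Hd ?tX // Hx // !tE td tc.
  - by rewrite tc Hw ?tX // Hc // !tE td.
  - by rewrite tw Hc ?tX // Hw // !tE tx.
exists t; last by [].
apply: isoOn_mk => //; first by move=> u v _ _; apply: inv_inj.
move=> u v uX vX; have [/row->//|uN] := boolP (u \in [:: d; x; c; w]).
have [/row E|vN] := boolP (v \in [:: d; x; c; w]).
  by rewrite eS E // eS.
have fixt y : y \notin [:: d; x; c; w] -> t y = y.
  by rewrite !inE !negb_or /t => /and4P[/negPf-> /negPf-> /negPf-> /negPf->].
by rewrite !fixt.
Qed.

(** The side of a cut away from [y] contains only nonneighbours of [y], so it is [w] alone. The case
    [w := y] rules out a vertex adjacent to all the others. *)
Lemma disc_misses (T : finType) (e : rel T) (Y : {set T}) y w : simple e ->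
    disc e Y -> y \in Y -> (forall u, u \in Y -> u != y -> u != w -> e y u) ->
  [/\ w \in Y, w != y & forall u, u \in Y -> e w u = false].
Proof.
move=> [eS eI] dY yY Hy; have [S [b [/subsetP sS yS bY bS cl]]] := disc_at eS dY yY.
have outw u : u \in Y -> u \notin S -> u = w.
  move=> uY uS; apply/eqP; apply: contraT => uw.
  have uy : u != y by apply: contra uS => /eqP->.
  by have := Hy u uY uy uw; rewrite cl.
have bw := outw b bY bS; subst b.
split=> //; first by apply: contra bS => /eqP->.
move=> u uY; have [uS|/(outw u uY)->] := boolP (u \in S); last exact: eI.
by rewrite eS cl.
Qed.

(* If [d'] pulls back to [x <> d], then [d] and [x] play symmetric roles: an
   automorphism exchanges them. *)
Lemma isoOn_root (T : finType) (e e' : rel T) X X' d c d' c' f :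
    simple e -> simple e' ->
    misses_only e X d c -> misses_only e' X' d' c' ->
    disc e (X :\ d) -> disc e' (X' :\ d') -> isoOn e e' X X' f ->
  exists g, [/\ isoOn e e' X X' g, g d = d' & g c = c'].
Proof.
move=> eG eG' mo mo' dX dX' fi.
have [dinX cX cd Hd] := mo; have [dinX' cX' cd' Hd'] := mo'.
have [[eS eI] [eS' eI']] := (eG, eG'); have [fI fB fe] := fi.
(* [c] and [c'] follow for free, being the only vertices that [d] and [d'] miss. *)
suff [g gi gd] : exists2 g, isoOn e e' X X' g & g d = d'.
  exists g; split=> //; apply/eqP; apply: contraT => gc; have [gI _ ge] := gi.
  have := ge _ _ dinX cX; rewrite gd Hd' ?(isoOn_mem gi) // Hd // eqxx andbF gc andbT.
  by rewrite -gd (inj_in_eq gI) // cd.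
have [x xX fx] := isoOn_onto fi dinX'; have [w wX fw] := isoOn_onto fi cX'.
have wx : w != x by rewrite -(inj_in_eq fI) // fx fw.
have Hx u : u \in X -> e x u = (u != x) && (u != w).
  by move=> uX; rewrite -fe // fx Hd' ?(isoOn_mem fi) // -fx -fw !(inj_in_eq fI).
have [xd|xd] := eqVneq x d; first by exists f; rewrite // -xd.
(* If [c] played the part of [d], it would miss only [d] and be adjacent to all other vertices of
   [X :\ d], which is disconnected. *)
have xc : x != c.
  apply/eqP=> xc; subst x; have wd : w = d.
    have := Hd c cX; rewrite eqxx andbF eS Hx // eq_sym cd /= => /negbFE/eqP//.
  subst w; have cXd : c \in X :\ d by rewrite !inE cd.
  have [|_ + _] := @disc_misses _ e (X :\ d) c c eG dX cXd; last by rewrite eqxx.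
  by move=> u /setD1P[ud uX] uc _; rewrite Hx // ud uc.
have xXd : x \in X :\ d by rewrite !inE xd.
have [|wXd _ wi] := @disc_misses _ e (X :\ d) x w eG dX xXd.
  by move=> u /setD1P[_ uX] ux uw; rewrite Hx // ux.
have /setD1P[wd _] := wXd.
(* If they miss the same vertex, [d] and [x] are twins. Otherwise [w] sees only [d], the same
   argument on the side of [e'] shows that [c] sees only [x], and both pairs can be swapped. *)
have [wc|wc] := eqVneq w c.
  subst w; have ti : isoOn e e X X (tperm d x).
    by apply: isoOn_twins => // u uX ud ux; rewrite Hd // Hx // ud ux.
  by exists (f \o tperm d x); [apply: isoOn_comp ti fi|rewrite /= tpermL].
have Hw u : u \in X -> e w u = (u == d).
  move=> uX; have [->|ud] := eqVneq u d; first by rewrite eS Hd // wd.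
  by apply: wi; rewrite !inE ud.
have fd' : f d != d' by rewrite -fx (inj_in_eq fI) // eq_sym.
have fdX' := isoOn_mem fi dinX.
have fdXd' : f d \in X' :\ d' by rewrite !inE fd'.
have [|_ _ ci] := @disc_misses _ e' (X' :\ d') (f d) (f c) eG' dX' fdXd'.
  move=> _ /setD1P[_ /(isoOn_onto fi)[u uX <-]].
  by rewrite !(inj_in_eq fI) // fe // Hd // => -> ->.
have Hc u : u \in X -> e c u = (u == x).
  move=> uX; have [->|ux] := eqVneq u x; first by rewrite eS Hx // eq_sym xc eq_sym.
  by rewrite -fe // ci // !inE (isoOn_mem fi) // andbT -fx (inj_in_eq fI).
have mox : misses_only e X x w by split.
have [dx cw] : d != x /\ c != w by rewrite eq_sym xd eq_sym wc.
have [t ti [td tx tc tw]] := isoOn_double_swap eG mo mox dx cw Hc Hw.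
by exists (f \o t); [apply: isoOn_comp ti fi|rewrite /= td].
Qed.

Lemma isoOn_hinge (T : finType) (e e' : rel T) d c d' c' h :
    simple e -> simple e' ->
    misses_only e setT d c -> misses_only e' setT d' c' ->
    isoOn e e' [set~ d] [set~ d'] h -> h c = c' -> isoT e e'.
Proof.
move=> eG eG' [_ _ cd Hd] [_ _ cd' Hd'] hi hc.
have := isoOn_add (d := d) (d' := d') eG eG' hi.
rewrite !setUCr => H; exists (fun x => if x == d then d' else h x); apply: H.
- by rewrite !inE eqxx.
- by rewrite !inE eqxx.
move=> x xd; have [hI _ _] := hi; have := isoOn_mem hi xd.
have cA : c \in [set~ d] by rewrite !inE.
rewrite Hd ?in_setT // Hd' ?in_setT // -hc (inj_in_eq hI xd cA).
by move: xd; rewrite !inE => -> ->.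
Qed.

(** The card at a vertex [v] outside the component of [c] keeps that component whole. [isoOn_root]
    makes the isomorphism of cards respect the roots, and [isoOn_cancel] fits the rooted component
    into an isomorphism of the cards at [d] and [d']. *)
Lemma hinge_recon_robust (T : finType) (e e' : rel T) s d c d' c' :
    simple e -> simple e' -> deck_by e e' s -> s d = d' ->
    misses_only e setT d c -> misses_only e' setT d' c' ->
    disc e [set~ d] -> (forall v, v != d -> disc e ([set~ d] :\ v)) ->
  isoT e e'.
Proof.
move=> eG eG' sd sdd mo mo' dA rob.
have [[eS eI] [eS' eI']] := (eG, eG').
have rob' v : v != d' -> disc e' ([set~ d'] :\ v).
  move=> vd'; have [f fi] := sd.2 d; rewrite sdd in fi.
  have [g [gi _ _]] := isoOn_inv d fi.
  have vA : v \in [set~ d'] by rewrite !inE.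
  apply: (isoOn_disc (isoOn_del gi vA)); apply: rob.
  by have := isoOn_mem gi vA; rewrite !inE.
have dA' : disc e' [set~ d'].
  by have [f fi] := sd.2 d; rewrite sdd in fi; have [g [gi _ _]] := isoOn_inv d fi;
     apply: isoOn_disc gi dA.
(* The image of the component of [c] is only known to lie inside that of [c']; comparing sizes turns
   the inclusion into equality. *)
wlog le : e e' s d c d' c' eG eG' sd sdd mo mo' dA dA' rob rob' eS eI eS' eI' /
    #|cls e' [set~ d'] c'| <= #|cls e [set~ d] c|.
  move=> W; have [le|/ltnW le] := leqP #|cls e' [set~ d'] c'| #|cls e [set~ d] c|.
    exact: (W e e' s d c d' c').
  have [s' sd' [sK _]] := deck_sym sd.
  have [f fi] : isoT e' e by apply: (W e' e s' d' c' d c) => //; rewrite -sdd sK.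
  by have [g [gi _ _]] := isoOn_inv d fi; exists g.
have [_ _ cd Hd] := mo; have [_ _ cd' Hd'] := mo'.
have cA : c \in [set~ d] by rewrite !inE.
have cA' : c' \in [set~ d'] by rewrite !inE.
have [v vA vK] := disc_cls eS dA cA.
have vd : v != d by move: vA; rewrite !inE.
have vc : v != c by apply: contraNneq vK => ->; apply: cls_refl.
have [f fi] := sd.2 v; have [sI _] := sd.
have svd : s v != d' by rewrite -sdd (inj_eq sI).
have dv : disc e ([set~ v] :\ d).
  by rewrite (_ : _ :\ d = [set~ d] :\ v) ?rob //; apply/setP=> u; rewrite !inE andbC.
have dv' : disc e' ([set~ s v] :\ d').
  by rewrite (_ : _ :\ d' = [set~ d'] :\ s v) ?rob' //; apply/setP=> u; rewrite !inE andbC.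
(* Were [c'] deleted, [d'] would be adjacent to everything left, hence so would some [x] in the card
   at [v]. As [d] misses [c], this [x] is not [d] and would connect what remains without [d]. *)
have svc : s v != c'.
  apply/eqP=> svc; have d'v : d' \in [set~ s v] by rewrite !inE eq_sym.
  have [x xv fx] := isoOn_onto fi d'v; have [fI _ fe] := fi.
  have Hx u : u \in [set~ v] -> u != x -> e x u.
    move=> uv ux; rewrite -fe // fx Hd' ?in_setT // -svc.
    by rewrite -fx (inj_in_eq fI) // ux /=; have := isoOn_mem fi uv; rewrite !inE.
  have xd : x != d.
    apply/eqP=> xd; have := Hx c; rewrite xd !inE eq_sym vc cd => /(_ isT isT).
    by rewrite Hd ?in_setT // eqxx andbF.
  have xX : x \in [set~ v] :\ d by move: xv; rewrite !inE xd.
  have [|_ + _] := @disc_misses _ e ([set~ v] :\ d) x x eG dv xX; last by rewrite eqxx.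
  by move=> u /setD1P[_ uv] ux _; apply: Hx.
have mov : misses_only e [set~ v] d c.
  by split; rewrite ?inE // 1?eq_sym // => u _; rewrite Hd ?in_setT.
have mov' : misses_only e' [set~ s v] d' c'.
  by split; rewrite ?inE // 1?eq_sym // => u _; rewrite Hd' ?in_setT.
have [g [gi gd gc]] := isoOn_root eG eG' mov mov' dv dv' fi.
have dX : d \in [set~ v] by case: mov.
have gi2 : isoOn e e' ([set~ d] :\ v) ([set~ d'] :\ s v) g.
  have -> : [set~ d] :\ v = [set~ v] :\ d by apply/setP=> u; rewrite !inE andbC.
  have -> : [set~ d'] :\ s v = [set~ s v] :\ d' by apply/setP=> u; rewrite !inE andbC.
  by rewrite -gd; apply: isoOn_del.
have cAv : c \in [set~ d] :\ v by rewrite !inE cd eq_sym vc.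
have cAv' : c' \in [set~ d'] :\ s v by rewrite !inE cd' eq_sym svc.
have imK := isoOn_cls eS' gi2 cAv; rewrite gc cls_del // in imK.
have [gI _ _] := gi2.
have Kiso : isoOn e e' (cls e [set~ d] c) (cls e' [set~ d'] c') g.
  have sK : cls e [set~ d] c \subset [set~ d] :\ v by rewrite subsetD1 cls_subA.
  have := isoOn_sub gi2 sK; suff -> : g @: cls e [set~ d] c = cls e' [set~ d'] c' by [].
  apply/eqP; rewrite eqEcard card_in_imset.
    by rewrite le andbT imK; apply: cls_mono; rewrite ?subD1set.
  by move=> a b /(subsetP sK) aK /(subsetP sK) bK; apply: gI.
have [phi phii] := sd.2 d; rewrite sdd in phii.
have [h hi hK] := isoOn_cancel eG eG' cA cA' phii Kiso.
apply: (isoOn_hinge eG eG' mo mo' hi).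
by rewrite hK ?cls_refl.
Qed.

(** * Rooting by an independent set *)

(** The assumption for graphs with a dominating pair, restated on vertex subsets of any type because
    the gadgets live on subsets of [T + 'I_M]. It is derived as [set_recon]. *)
Definition set_recon_hyp : Prop :=
  forall (U : finType) (r r' : rel U) (V V' : {set U}) (s : U -> U),
    simple r -> simple r' -> 2 < #|V| ->
    {in V &, injective s} -> s @: V = V' ->
    (forall v, v \in V -> exists f, isoOn r r' (V :\ v) (V' :\ s v) f) ->
    ~~ disc r V -> (forall v, v \in V -> ~~ disc r (V :\ v)) ->
    (exists a b, [/\ a \in V, b \in V &
       forall x, x \in V -> [|| x == a, x == b, r a x | r b x]]) ->
  exists f, isoOn r r' V V' f.

(* For large [M] the new vertices form the only large independent set, which
   makes [d] recognizable. *)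
Definition gad (T : finType) (e : rel T) (d : T) (M : nat) : rel (T + 'I_M) :=
  fun p q => match p, q with
  | inl x, inl y => e x y
  | inl x, inr i => (x != d) || (i != 0 :> nat)
  | inr i, inl x => (x != d) || (i != 0 :> nat)
  | inr _, inr _ => false
  end.

Definition gset (T : finType) (M : nat) (V : {set T}) (S : {set 'I_M}) : {set T + 'I_M} :=
  [set p | match p with inl x => x \in V | inr i => i \in S end].

Definition gmap (T : finType) (M : nat) (f : T -> T) (p : T + 'I_M) : T + 'I_M :=
  match p with inl x => inl (f x) | inr i => inr i end.

Section Gadget.
Variables (T : finType) (M : nat).
Implicit Types (V : {set T}) (S : {set 'I_M}).

Lemma simple_gad (e : rel T) d : simple e -> simple (gad e d (M := M)).
Proof. by case=> eS eI; split=> [[x|i] [y|j]|[x|i]] //=; rewrite ?eS ?eI. Qed.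

Lemma gset_dell V S v : gset V S :\ inl v = gset (V :\ v) S.
Proof. by apply/setP=> -[x|i]; rewrite !inE. Qed.

Lemma gset_delr V S i : gset V S :\ inr i = gset V (S :\ i).
Proof. by apply/setP=> -[x|j]; rewrite !inE. Qed.

Lemma card_gset V S : #|gset V S| = #|V| + #|S|.
Proof.
rewrite -sum1_card big_sumType /= -!sum1_card.
by congr (_ + _); apply: eq_bigl => x; rewrite inE.
Qed.

(** Only the new vertex [0] distinguishes [d]: when it is absent from [S], any isomorphism lifts,
    whatever it does to [d]. *)
Lemma gad_lift (e e' : rel T) d d' V V' S f : isoOn e e' V V' f ->
    (forall x i, x \in V -> i \in S -> i = 0 :> nat -> (f x == d') = (x == d)) ->
  isoOn (gad e d (M := M)) (gad e' d' (M := M)) (gset V S) (gset V' S) (gmap f).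
Proof.
move=> fi root; have [fI fB fe] := fi; apply: isoOn_mk.
- by move=> [x|i] [y|j]; rewrite !inE //= => xV yV [] // /fI ->.
- by move=> [x|i]; rewrite !inE //=; apply: isoOn_mem fi.
- by rewrite !card_gset (isoOn_card fi).
have key x i : x \in V -> i \in S -> (f x != d') || (i != 0 :> nat) = (x != d) || (i != 0 :> nat).
  by move=> xV iS; have [i0|] := eqVneq (i : nat) 0; rewrite ?orbT // (root x i).
by move=> [x|i] [y|j]; rewrite !inE //= => xV yV; rewrite ?fe ?key.
Qed.

Lemma gad_conn (e : rel T) d V S y : simple e -> ~~ disc e V -> y \in V -> y != d ->
  ~~ disc (gad e d (M := M)) (gset V S).
Proof.
move=> eG nd yV yd; have [gS _] := simple_gad d eG.
apply: (conn_attach (B := gset V set0) (b := inl y)) => //.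
- by rewrite !inE.
- by apply/subsetP=> -[x|i]; rewrite !inE.
- apply: contra nd; apply: (isoOn_disc (f := inl)); apply: isoOn_mk => //.
  + by move=> x z _ _ [].
  + by move=> x; rewrite !inE.
  + by rewrite card_gset cards0 addn0.
- move=> [x|i]; rewrite !inE => //= iS; first by rewrite iS.
  by exists (inl y); rewrite ?inE //= yd.
Qed.

(** [V] may be disconnected here: [i0] reaches every old vertex except possibly [d], and a neighbour
    of [d] reaches [d] and all new vertices. *)
Lemma gad_conn_hub (e : rel T) d V S y (i0 : 'I_M) : simple e -> i0 \in S ->
  y \in V -> e d y -> ~~ disc (gad e d (M := M)) (gset V S).
Proof.
move=> eG i0S yV dy; have [gS _] := simple_gad d eG.
have yd : y != d by apply: contraTneq dy => ->; rewrite eG.2.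
apply: (conn_hub (h := inr i0)); rewrite ?inE //.
move=> [x|j]; rewrite inE => xV.
  have [->|xd] := eqVneq x d; last by constructor 2; rewrite /= xd.
  by constructor 3; exists (inl y); rewrite !inE /= yd eG.1.
by constructor 3; exists (inl y); rewrite !inE /= yd.
Qed.
End Gadget.

Lemma gad_rigid (T : finType) (e e' : rel T) d d' (V V' : {set T}) M F :
    d \in V -> #|T| + 2 < M -> #|V| = #|V'| ->
    isoOn (gad e d (M := M)) (gad e' d' (M := M)) (gset V setT) (gset V' setT) F ->
  exists2 g, isoOn e e' V V' g & g d = d'.
Proof.
move=> dV cM cV Fi; have [FI FB Fe] := Fi.
have iV i : inr i \in gset V [set: 'I_M] by rewrite !inE.
have xV x : x \in V -> inl x \in gset V [set: 'I_M] by rewrite !inE.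
have FiI : injective (fun i : 'I_M => F (inr i)).
  by move=> i j /FI; rewrite !iV => /(_ isT isT) [].
have indep i j : gad e' d' (F (inr i)) (F (inr j)) = false by rewrite Fe.
have inrF i : exists k, F (inr i) = inr k.
  case Fx: (F (inr i)) => [x|k]; last by exists k.
  have cF : #|[set F (inr i) | i : 'I_M]| = M by rewrite card_imset // card_ord.
  (* An old image can coexist with a new one only as [d'] beside the vertex [0], which leaves two
     possible images in all; if every image is old, there are at most [#|T|]. Both numbers are below
     [M]. *)
  case: (boolP [exists j, if F (inr j) is inr _ then true else false]) => [/existsP[j]|].
    case Fk: (F (inr j)) => [//|k] _.
    have := indep i j; rewrite Fx Fk /= => /negbT/norP[/negPn/eqP xd /negPn/eqP k0].
    suff : [set F (inr i) | i : 'I_M] \subset [set inl d'; inr k].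
      by move/subset_leq_card; rewrite cF cards2 /=; lia.
    apply/subsetP=> _ /imsetP[l _ ->]; rewrite !inE.
    case Fl: (F (inr l)) => [y|k2].
      have := indep l j; rewrite Fl Fk /= => /negbT/norP[/negPn/eqP-> _].
      by rewrite eqxx.
    have := indep i l; rewrite Fx Fl /= => /negbT/norP[_ /negPn/eqP k20].
    by apply/eqP; congr inr; apply: val_inj; rewrite /= k0.
  move=> /existsPn noinr.
  suff : [set F (inr i) | i : 'I_M] \subset [set inl x | x in [set: T]].
    move/subset_leq_card; rewrite cF card_imset ?cardsT; last by move=> u v [].
    by lia.
  apply/subsetP=> _ /imsetP[l _ ->]; have := noinr l.
  by case: (F (inr l)) => // y _; rewrite imset_f.
have inrS k : exists i, F (inr i) = inr k.
  pose h i := if F (inr i) is inr k then k else i.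
  have hE i : F (inr i) = inr (h i) by rewrite /h; have [k' ->] := inrF i.
  have hI : injective h by move=> i j hij; apply: FiI; rewrite /= !hE hij.
  by exists (invF hI k); rewrite hE f_invF.
pose g x := if F (inl x) is inl y then y else x.
have gE x : x \in V -> F (inl x) = inl (g x).
  move=> xV'; rewrite /g; case Fx: (F (inl x)) => [//|k].
  have [i Fk] := inrS k; rewrite -Fk in Fx.
  by have := FI _ _ (xV _ xV') (iV i) Fx.
exists g; first apply: isoOn_mk; last 1 first.
- have M0 : 0 < M by lia.
  have [k Fk] := inrF (Ordinal M0).
  have := Fe _ _ (xV _ dV) (iV (Ordinal M0)); rewrite gE // Fk /= eqxx /=.
  by case/negbT/norP=> /negPn/eqP.
- by move=> x y xA yA gxy; have := FI _ _ (xV _ xA) (xV _ yA); rewrite !gE // gxy => /(_ erefl) [].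
- by move=> x xA; have := isoOn_mem Fi (xV _ xA); rewrite gE // inE.
- by rewrite cV.
- by move=> x y xA yA; have := Fe _ _ (xV _ xA) (xV _ yA); rewrite !gE.
Qed.

(* The gadget graphs are reconstructed by induction on the number of new
   vertices; deleting an old vertex gives a card that is known because it is
   already rooted at [d]. *)
Lemma rooted_recon (T : finType) (e e' : rel T) d d' (V V' : {set T}) s :
    set_recon_hyp -> simple e -> simple e' -> d \in V ->
    {in V &, injective s} -> s @: V = V' -> s d = d' ->
    (exists h, isoOn e e' V V' h) ->
    (exists h, isoOn e e' (V :\ d) (V' :\ d') h) ->
    (forall v, v \in V -> v != d -> exists2 g, isoOn e e' (V :\ v) (V' :\ s v) g & g d = d') ->
    ~~ disc e V -> ~~ disc e (V :\ d) ->
    (exists y1 y2, [/\ y1 \in V, y2 \in V, y1 != y2, e d y1 & e d y2]) ->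
  exists2 g, isoOn e e' V V' g & g d = d'.
Proof.
move=> HA eG eG' dV sI sV sdd [h hi] [h0 h0i] cards nd ndd [y1 [y2 [y1V y2V y12 dy1 dy2]]].
have [eS eI] := eG.
have yd y : e d y -> y != d by move=> dy; apply: contraTneq dy => ->; rewrite eI.
pose M := (#|T| + 3)%N.
have cV : #|V| = #|V'| by apply: isoOn_card hi.
suff all n (S : {set 'I_M}) : #|S| = n ->
    exists F, isoOn (gad e d (M := M)) (gad e' d' (M := M)) (gset V S) (gset V' S) F.
  have [F Fi] := all _ setT erefl.
  by apply: gad_rigid Fi => //; rewrite /M; lia.
elim: n S => [|n IH] S cS.
  exists (gmap h); apply: gad_lift hi _ => x i _.
  by rewrite (cards0_eq cS) inE.
case: (boolP [exists i in S, i == 0 :> nat]) => [/exists_inP[i0 i0S /eqP i00]|/exists_inPn no0]; last first.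
  by exists (gmap h); apply: gad_lift hi _ => x i _ /no0/eqP.
apply: (HA _ _ _ _ _ (gmap s)); try exact: simple_gad.
- have : 2 < #|V|.
    apply/card_gt2P; exists d, y1, y2; split; split=> //; last by apply: yd.
    by rewrite eq_sym yd.
  by rewrite card_gset; lia.
- by move=> [x|i] [y|j]; rewrite !inE //= => xV yV [] // /sI ->.
- apply/setP=> -[x|i]; rewrite inE; apply/imsetP/idP.
  + by case=> -[y|j]; rewrite inE //= => yV [->]; rewrite -sV imset_f.
  + by rewrite -sV => /imsetP[y yV ->]; exists (inl y); rewrite ?inE.
  + by case=> -[y|j]; rewrite inE //= => yV [->].
  + by move=> iS; exists (inr i); rewrite ?inE.
- move=> [v|i]; rewrite inE => vV /=; last first.
    rewrite !gset_delr; apply: IH.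
    by have := cardsD1 i S; rewrite vV cS add1n => -[<-].
  (* With [d] itself deleted there is no root to respect, so the unrooted card at [d] lifts. *)
  rewrite !gset_dell; have [->|vd] := eqVneq v d.
    exists (gmap h0); rewrite sdd; apply: (gad_lift h0i) => x i xV _ _.
    have := isoOn_mem h0i xV; move: xV; rewrite !inE => /andP[/negPf-> _].
    by case/andP=> /negPf->.
  have [g gi gd] := cards v vV vd; exists (gmap g).
  apply: (gad_lift gi) => x i xV _ _; have [gI _ _] := gi.
  by rewrite -gd (inj_in_eq gI) // !inE dV eq_sym vd.
- by apply: (gad_conn _ eG nd y1V); apply: yd.
- move=> [v|i]; rewrite inE => vV; last first.
    by rewrite gset_delr; apply: (gad_conn _ eG nd y1V); apply: yd.
  rewrite gset_dell; have [->|vd] := eqVneq v d.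
    by apply: (gad_conn _ eG ndd (y := y1)); rewrite ?inE ?yd.
  (* One of two neighbours of [d] survives the deletion of [v], which keeps the gadget connected
     even if [V :\ v] falls apart. *)
  have [y1v|y1v] := eqVneq y1 v.
    by apply: (gad_conn_hub eG i0S (y := y2)) => //; rewrite !inE y2V -y1v eq_sym y12.
  by apply: (gad_conn_hub eG i0S (y := y1)) => //; rewrite !inE y1V y1v.
(* [i0] dominates all old vertices but [d]; [y1] dominates [d] and all new vertices. *)
- exists (inr i0), (inl y1); rewrite !inE; split=> //.
  move=> [x|j] _ /=; last by rewrite (yd _ dy1) !orbT.
  have [->|xd] := eqVneq x d; last by rewrite orbT.
  by rewrite eS dy1 !orbT.
Qed.

Lemma disc_setT_nbr (T : finType) (e : rel T) x y : symmetric e -> ~~ disc e setT ->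
  x != y -> exists w, e x w.
Proof.
move=> eS nd xy; case: (pickP (e x)) => [w xw|no]; first by exists w.
by case/negP: nd; apply: (isolated_disc (z := x) (x := y)); rewrite // eq_sym.
Qed.

(** * Hinges with a pendant vertex *)

Definition pendant_hinge (T : finType) (e : rel T) (d c z : T) : Prop :=
  [/\ misses_only e setT d c, z != d, c != z, forall u, e z u = (u == d)
    & ~~ disc e ([set~ d] :\ z)].

(** Removing [z] connects the card at [d], so [z] is isolated there and its only neighbour is [d].
    Were it [c], it would be isolated in the whole graph. *)
Lemma pendant_hinge_mk (T : finType) (e : rel T) d c z : simple e ->
    misses_only e setT d c -> ~~ disc e setT -> z != d -> disc e [set~ d] ->
    ~~ disc e ([set~ d] :\ z) ->
  pendant_hinge e d c z.
Proof.
move=> eG mo nd zd dA nJ; have [eS eI] := eG; have [_ _ cd Hd] := mo.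
have zA : z \in [set~ d] by rewrite !inE.
have iso := disc_del_isolated eS eI zA dA nJ.
have cz : c != z.
  apply/eqP=> cz; have [w cw] := disc_setT_nbr eS nd cd.
  have wA : w \in [set~ d].
    by rewrite !inE; apply: contraTneq cw => ->; rewrite eS Hd ?in_setT // eqxx andbF.
  by rewrite cz iso in cw.
split=> // u; have [->|ud] := eqVneq u d; last by apply: iso; rewrite !inE.
by rewrite eS Hd ?in_setT // zd eq_sym.
Qed.

Section PendantHinge.
Variables (T : finType) (e : rel T) (d c z : T).
Hypotheses (eG : simple e) (ph : pendant_hinge e d c z) (nd : ~~ disc e setT).

Lemma ph_nbr : exists y, [/\ y != c, y != d, y != z & e c y].
Proof.
have [eS eI] := eG; have [[_ _ cd Hd] zd cz Hz nJ] := ph.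
have [w cw] := disc_setT_nbr eS nd cd; exists w; split=> //.
- by apply: contraTneq cw => ->; rewrite eI.
- by apply: contraTneq cw => ->; rewrite eS Hd ?in_setT // eqxx andbF.
- by apply: contraTneq cw => ->; rewrite eS Hz.
Qed.

Lemma ph_conn_del : ~~ disc e [set~ z].
Proof.
have [eS eI] := eG; have [[_ _ cd Hd] zd cz Hz nJ] := ph.
have [y [yc yd yz cy]] := ph_nbr.
apply: (conn_attach (B := [set~ d] :\ z) (b := y)) => //; rewrite ?inE ?yz //.
  by apply/subsetP=> u; rewrite !inE => /andP[].
move=> x; rewrite !inE => xz; rewrite xz negbK => /eqP->.
by exists y; rewrite ?inE ?yz // Hd ?in_setT // yd.
Qed.

(** [d] is adjacent to [z] and to a neighbour of [c]. Any further vertex besides [z] and [c] is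
    adjacent to [d] and, by connectedness, to something in [[set~ d] :\ z]. *)
Lemma ph_deg1 x : deg e x = 1 -> x = z \/ x = c.
Proof.
have [eS eI] := eG; have [[_ _ cd Hd] zd cz Hz nJ] := ph.
have [y [yc yd yz cy]] := ph_nbr.
move=> dx; have two u v : u != v -> e x u -> e x v -> False.
  move=> uv xu xv; have : 1 < deg e x by apply/card_gt1P; exists u, v; rewrite !inE.
  by rewrite dx.
have [->|xz] := eqVneq x z; first by left.
have [->|xc] := eqVneq x c; first by right.
have [xd|xd] := eqVneq x d.
  by case: (two y z) => //; rewrite xd Hd ?in_setT // ?yd // zd eq_sym.
case: (pickP (fun w => (w \in [set~ d] :\ z) && e x w)) => [w /andP[wJ xw]|no].
  have wd : w != d by move: wJ; rewrite !inE => /andP[].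
  by case: (two w d) => //; rewrite eS Hd ?in_setT // xd.
case/negP: nJ; apply: (isolated_disc (z := x) (x := c)) => //; rewrite ?inE ?xz ?cz ?xd //.
  by rewrite eq_sym.
by move=> w wJ; have := no w; rewrite wJ.
Qed.

Lemma ph_deg : deg e z = 1.
Proof.
have [_ _ _ Hz _] := ph; rewrite -(cards1 d) /deg.
by apply: eq_card => u; rewrite !inE Hz.
Qed.

(** As [z] is not deleted, a vertex adjacent to all the rest must be its only neighbour. It cannot
    be [z] itself, since [c] or a neighbour of [c] also remains. *)
Lemma ph_universal u w : w != z -> w != d -> u != w ->
  (forall x, x != w -> x != u -> e u x) -> u = d.
Proof.
have [eS eI] := eG; have [_ zd cz Hz _] := ph.
have [y [yc yd yz cy]] := ph_nbr.
move=> wz wd uw Hu; have [uz|uz] := eqVneq u z.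
  have [cw|cw] := eqVneq c w.
    by have := Hu y; rewrite -cw uz Hz yc yz (negPf yd) => /(_ isT isT).
  have [[_ _ cd _] _ _ _ _] := ph.
  by have := Hu c; rewrite uz Hz cw cz (negPf cd) => /(_ isT isT).
have := Hu z; rewrite eS Hz eq_sym wz eq_sym uz => /(_ isT isT).
by move/eqP.
Qed.
End PendantHinge.

(** The vertex [t] sent to [z'] is pendant at [d] just like [z], so swapping the two first makes [z]
    correspond to [z']. *)
Lemma isoOn_pendant (T : finType) (e e' : rel T) d c z d' c' z' v v' g :
    simple e -> simple e' -> pendant_hinge e d c z -> pendant_hinge e' d' c' z' ->
    v != d -> v != z -> v' != z' -> v' != d' ->
    isoOn e e' [set~ v] [set~ v'] g -> g d = d' ->
  exists2 g2, isoOn e e' ([set~ z] :\ v) ([set~ z'] :\ v') g2 & g2 d = d'.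
Proof.
move=> eG eG' [_ zd cz Hz _] [_ zd' cz' Hz' _] vd vz vz' vd' gi gd.
have [gI _ ge] := gi.
have zX' : z' \in [set~ v'] by rewrite !inE eq_sym.
have zX : z \in [set~ v] by rewrite !inE eq_sym.
have dX : d \in [set~ v] by rewrite !inE eq_sym.
have [t tX gt] := isoOn_onto gi zX'.
have ti : isoOn e e [set~ v] [set~ v] (tperm z t).
  apply: isoOn_twins => // u uX _ _.
  by rewrite Hz -ge // gt Hz' -gd (inj_in_eq gI).
have td : d != t by apply: contraNneq zd' => td; rewrite -gt -td gd.
exists (g \o tperm z t); last by rewrite /= tpermD // eq_sym.
have -> : [set~ z] :\ v = [set~ v] :\ z by apply/setP=> u; rewrite !inE andbC.
have -> : [set~ z'] :\ v' = [set~ v'] :\ z' by apply/setP=> u; rewrite !inE andbC.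
have := isoOn_del (isoOn_comp ti gi) zX.
by rewrite /= tpermL gt.
Qed.

(** Degree one leaves [s] only the choice of keeping or exchanging the roles of [z] and [c]. In the
    exchanged case an automorphism of [e'] swaps [z'] with [c'], so [s] composed with a
    transposition still matches the cards. *)
Lemma pendant_deck_normalize (T : finType) (e e' : rel T) s d c z d' c' z' :
    simple e -> simple e' -> 2 < #|T| -> deck_by e e' s -> s d = d' ->
    pendant_hinge e d c z -> pendant_hinge e' d' c' z' ->
    ~~ disc e setT -> ~~ disc e' setT ->
  exists s2, [/\ deck_by e e' s2, s2 d = d', s2 z = z' & s2 c = c'].
Proof.
move=> eG eG' cT sd sdd ph ph' nd nd'.
have [eS eI] := eG; have [eS' eI'] := eG'.
have [[_ _ cd Hd] zd cz Hz nJ] := ph; have [[_ _ cd' Hd'] zd' cz' Hz' nJ'] := ph'.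
have degs v := deck_deg v eG eG' cT sd.
have [sI sc] := sd; have [f fi] := sc c; have [fI _ fe] := fi.
have dc : d \in [set~ c] by rewrite !inE eq_sym.
have fdc : f d != s c by have := isoOn_mem fi dc; rewrite !inE.
have uni x : x != s c -> x != f d -> e' (f d) x.
  move=> xc; have xX : x \in [set~ s c] by rewrite !inE.
  have [w wX <-] := isoOn_onto fi xX.
  rewrite (inj_in_eq fI) // fe // Hd ?in_setT // => ->.
  by move: wX; rewrite !inE.
have : s z = z' \/ s z = c'.
  by apply: (ph_deg1 eG' ph' nd'); rewrite degs (ph_deg ph).
case=> [sz|szc].
  exists s; split=> //; apply/eqP; apply: contraT => scc.
  have scz : s c != z' by rewrite -sz (inj_eq sI).
  have scd : s c != d' by rewrite -sdd (inj_eq sI).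
  have fd := ph_universal eG' ph' nd' scz scd fdc uni.
  by have := uni c'; rewrite fd Hd' ?in_setT // eqxx andbF eq_sym scc cd' => /(_ isT isT).
have scz : s c = z'.
  have [|E|E] := ph_deg1 eG ph nd (x := invF sI z').
  + by rewrite -degs f_invF (ph_deg ph').
  + by move: cz'; rewrite -szc -E f_invF eqxx.
  + by rewrite -E f_invF.
rewrite scz in uni fdc fi.
(* [d] is adjacent to everything else in the card at [c], so [u] misses only [z']. As [c'] has
   degree one, [u] is its only neighbour, which is the configuration for swapping [d'] with [u] and
   [c'] with [z']. *)
set u := f d in uni fdc.
have ud : u != d'.
  apply/eqP=> ud; have := uni c'; rewrite ud Hd' ?in_setT // eqxx andbF cz' cd'.
  by move/(_ isT isT).
have cu : c' != u.
  apply/eqP=> cu; have := uni d'; rewrite -cu eS' Hd' ?in_setT // eqxx andbF.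
  by rewrite eq_sym zd' eq_sym cd' => /(_ isT isT).
have e'cu : e' c' u by rewrite eS' uni.
have Hc' x : e' c' x = (x == u).
  apply/idP/eqP => [cx|->//]; apply/eqP; apply: contraT => xu.
  have : 1 < deg e' c' by apply/card_gt1P; exists x, u; rewrite !inE.
  by rewrite -szc degs (ph_deg ph).
have mou : misses_only e' setT u z'.
  split; rewrite ?inE // 1?eq_sym // => x _; have [->|xz] := eqVneq x z'.
    by rewrite andbF eS' Hz' (negPf ud).
  by have [->|xu] := eqVneq x u; [rewrite eI'|rewrite uni].
have mo' : misses_only e' setT d' c' by case: ph'.
have du : d' != u by rewrite eq_sym.
have [t ti [td tu tc tz]] := isoOn_double_swap eG' mo' mou du cz'
  (fun x _ => Hc' x) (fun x _ => Hz' x).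
exists (s \o tperm c z); split; last first.
- by rewrite /= tpermL.
- by rewrite /= tpermR.
- by rewrite /= tpermD.
split; first by move=> x y /= /sI /perm_inj.
move=> v /=; have [->|vc] := eqVneq v c.
  rewrite tpermL szc; exists (t \o f); apply: isoOn_comp fi _.
  by have := isoOn_del ti (in_setT z'); rewrite tz !setTD.
have [->|vz] := eqVneq v z.
  rewrite tpermR scz; have [f2 fi2] := sc z; rewrite szc in fi2.
  exists (t \o f2); apply: isoOn_comp fi2 _.
  by have := isoOn_del ti (in_setT c'); rewrite tc !setTD.
by rewrite tpermD 1?eq_sym.
Qed.

(** Since [z] is attached to [d] alone, an isomorphism of the cards at [z] and [z'] sending [d] to
    [d'] extends to the whole graph; [rooted_recon] supplies it. *)
Lemma hinge_recon_pendant (T : finType) (e e' : rel T) s0 d c d' c' z :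
    set_recon_hyp -> simple e -> simple e' -> 2 < #|T| -> deck_by e e' s0 -> s0 d = d' ->
    misses_only e setT d c -> misses_only e' setT d' c' ->
    ~~ disc e setT -> ~~ disc e' setT ->
    disc e [set~ d] -> z != d -> ~~ disc e ([set~ d] :\ z) ->
  isoT e e'.
Proof.
move=> HA eG eG' cT sd0 sdd0 mo mo' nd nd' dA zd nJ.
have [[eS eI] [eS' eI']] := (eG, eG').
have [phi phii] := sd0.2 d; rewrite sdd0 in phii.
have [phi' [phii' phiK phiK']] := isoOn_inv d phii.
have ph := pendant_hinge_mk eG mo nd zd dA nJ.
have zA : z \in [set~ d] by rewrite !inE.
pose z' := phi z.
have zA' : z' \in [set~ d'] by apply: isoOn_mem phii zA.
have Ji : isoOn e e' ([set~ d] :\ z) ([set~ d'] :\ z') phi by apply: isoOn_del.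
have zd' : z' != d' by move: zA'; rewrite !inE.
have ph' : pendant_hinge e' d' c' z'.
  apply: pendant_hinge_mk => //; first exact: isoOn_disc phii' dA.
  by apply: contra nJ; apply: isoOn_disc Ji.
have [_ _ cz Hz _] := ph; have [_ _ cz' Hz' _] := ph'.
have [_ _ cd Hd] := mo; have [_ _ cd' Hd'] := mo'.
have [phiI phiB phie] := phii.
have [y [yc yd yz cy]] := ph_nbr eG ph nd.
(* [rooted_recon] wants two neighbours of [d] besides [z]. If there is only [y], the graph has just
   the vertices [d], [c], [z], [y], and swapping [c] with [y] in the card at [d] repairs a wrong
   root. *)
case: (pickP (fun u => [&& u != d, u != c, u != z & u != y])) => [y2 /and4P[y2d y2c y2z y2y]|small]; last first.
  have [pc|pc] := eqVneq (phi c) c'; first exact: isoOn_hinge phii pc.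
  have cA' : c' \in [set~ d'] by rewrite !inE.
  have [x xA px] := isoOn_onto phii cA'.
  have xc : x != c by apply: contraNneq pc => <-; rewrite px.
  have xz : x != z by apply: contraNneq cz' => xz; rewrite -px xz.
  have xy : x = y.
    by have := small x; rewrite xc xz; move: xA; rewrite !inE => -> /= /negbFE/eqP.
  have cA : c \in [set~ d] by rewrite !inE.
  have ti : isoOn e e [set~ d] [set~ d] (tperm c y).
    apply: isoOn_twins => //; first by rewrite !inE.
    move=> u; rewrite !inE => ud uc uy; have := small u; rewrite ud uc uy /= andbT.
    by move/negbFE/eqP=> ->; rewrite !(eS _ z) !Hz (negPf cd) (negPf yd).
  by apply: (isoOn_hinge eG eG' mo mo' (isoOn_comp ti phii)); rewrite /= tpermL -xy.
have [s [sd sdd sz scc]] := pendant_deck_normalize eG eG' cT sd0 sdd0 ph ph' nd nd'.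
have [sI sc] := sd.
have swapz (D Z : T) : [set~ Z] :\ D = [set~ D] :\ Z.
  by apply/setP=> u; rewrite !inE andbC.
have [g gi gd] : exists2 g, isoOn e e' [set~ z] [set~ z'] g & g d = d'.
  apply: (@rooted_recon _ e e' d d' [set~ z] [set~ z'] s) => //.
  - by rewrite !inE eq_sym.
  - by move=> u v _ _; apply: sI.
  - apply/eqP; rewrite eqEcard card_imset // !cardsC1 leqnn andbT.
    by apply/subsetP=> _ /imsetP[u uz ->]; move: uz; rewrite !inE -sz (inj_eq sI).
  - by have := sc z; rewrite sz.
  - by exists phi; rewrite !(swapz _ z) (swapz _ z').
  - move=> v; rewrite !inE => vz vd.
    have svz : s v != z' by rewrite -sz (inj_eq sI).
    have svd : s v != d' by rewrite -sdd (inj_eq sI).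
    have [f fi] := sc v; have [fI _ fe] := fi.
    suff [g gi gd] : exists2 g, isoOn e e' [set~ v] [set~ s v] g & g d = d'.
      exact: isoOn_pendant eG eG' ph ph' vd vz svz svd gi gd.
    (* Deleting [c] makes [d] adjacent to all the rest, which singles out [d'] as its image. For any
       other [v] both [d] and [c] survive and [isoOn_root] applies, [z] being isolated once [d] is
       removed. *)
    have [vc|vc] := eqVneq v c.
      exists f => //; have dX : d \in [set~ v] by rewrite !inE eq_sym.
      apply: (ph_universal eG' ph' nd' svz svd).
        by have := isoOn_mem fi dX; rewrite !inE.
      move=> x xv; have xX : x \in [set~ s v] by rewrite !inE.
      have [w wX <-] := isoOn_onto fi xX.
      rewrite (inj_in_eq fI) // fe // Hd ?in_setT // => -> /=.
      by move: wX; rewrite !inE vc.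
    have svc : s v != c' by rewrite -scc (inj_eq sI).
    have [zv cv] : z != v /\ c != v by rewrite ![_ == v]eq_sym.
    have [zv' cv'] : z' != s v /\ c' != s v by rewrite ![_ == s v]eq_sym.
    have [|||||g [gi gd _]] := @isoOn_root _ e e' [set~ v] [set~ s v] d c d' c' f eG eG'.
    + by split; rewrite ?inE // 1?eq_sym // => u _; rewrite Hd ?in_setT.
    + by split; rewrite ?inE // 1?eq_sym // => u _; rewrite Hd' ?in_setT.
    + apply: (isolated_disc (z := z) (x := c)); rewrite ?inE ?zd ?cd //.
      by move=> u /setD1P[ud _]; rewrite Hz (negPf ud).
    + apply: (isolated_disc (z := z') (x := c')); rewrite ?inE ?zd' ?cd' //.
      by move=> u /setD1P[ud _]; rewrite Hz' (negPf ud).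
    + exact: fi.
    + by exists g.
  - exact: ph_conn_del ph nd.
  - by rewrite swapz.
  - exists y, y2; rewrite !inE; split=> //; first by rewrite eq_sym.
      by rewrite Hd ?in_setT // yd.
    by rewrite Hd ?in_setT // y2d.
have [gI _ _] := gi.
have := isoOn_add (d := z) (d' := z') eG eG' gi; rewrite !setUCr => H.
eexists; apply: H; rewrite ?inE ?eqxx // => x xz.
by rewrite Hz Hz' -gd (inj_in_eq gI) // !inE eq_sym.
Qed.

(** The deck determines degrees, so [s d] also misses a single vertex. *)
Lemma hinge_recon (T : finType) (e e' : rel T) s d c :
    set_recon_hyp -> simple e -> simple e' -> 2 < #|T| -> deck_by e e' s ->
    misses_only e setT d c -> ~~ disc e setT -> disc e [set~ d] ->
  isoT e e'.
Proof.
move=> HA eG eG' cT sd mo nd dA.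
have [nd'|dd'] := boolP (disc e' setT).
  have [s' sd' _] := deck_sym sd.
  have [f fi] := disc_recon eG' eG cT sd' nd'.
  by have [g [gi _ _]] := isoOn_inv d fi; exists g.
have [_ _ cd Hd] := mo.
have degE (r : rel T) u : irreflexive r -> #|[set y | y != u & ~~ r u y]| + deg r u + 1 = #|T|.
  move=> rI; have := cardsC [set y | r u y]; have := cardsD1 u (~: [set y | r u y]).
  have -> : ~: [set y | r u y] :\ u = [set y | y != u & ~~ r u y].
    by apply/setP=> y; rewrite !inE.
  by rewrite !inE rI /deg /=; lia.
have miss1 : #|[set y | y != d & ~~ e d y]| = 1.
  rewrite -(cards1 c); apply: eq_card => y; rewrite !inE Hd ?in_setT // negb_and.
  have [->|_] := eqVneq y d => /=; last by rewrite negbK.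
  by rewrite eq_sym (negPf cd).
have : #|[set y | y != s d & ~~ e' (s d) y]| == 1.
  have := degE e d eG.2; have := degE e' (s d) eG'.2.
  by rewrite (deck_deg d eG eG' cT sd) miss1; lia.
case/cards1P=> c' cE.
have mo' : misses_only e' setT (s d) c'.
  have : c' \in [set c'] by rewrite inE.
  rewrite -cE inE => /andP[cd' _]; split=> // y _.
  have /setP/(_ y) := cE; rewrite !inE => <-; have [->|yd] := eqVneq y (s d).
    by rewrite eG'.2.
  by rewrite /= negbK.
case: (boolP [exists z, (z != d) && ~~ disc e ([set~ d] :\ z)]) => [/existsP[z /andP[zd nJ]]|/existsPn no].
  exact: (hinge_recon_pendant HA eG eG' cT sd erefl mo mo' nd dd' dA zd nJ).
apply: (hinge_recon_robust eG eG' sd erefl mo mo' dA) => v vd.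
by have := no v; rewrite vd /= negbK.
Qed.

(** * Reduction to the hypothesis *)

Definition two_conn_hyp : Prop :=
  forall n (G : sgraph n.+1), two_connected G ->
    (domination_number G = 2 \/ (diam G = Some 2 /\ diam (compl G) = Some 2)) ->
  reconstructible G.

(** [a = b] is allowed: this encodes only that the domination number is at most two. *)
Definition dominating_pair (T : finType) (e : rel T) (A : {set T}) : Prop :=
  exists a b, [/\ a \in A, b \in A &
     forall x, x \in A -> [|| x == a, x == b, e a x | e b x]].

Definition mk_sgraph n (e : rel 'I_n) (eG : simple e) : sgraph n := SGraph eG.1 eG.2.

Lemma simple_adj n (G : sgraph n) : simple (adj G).
Proof. by split; [apply: adj_sym|apply: adj_irr]. Qed.

Lemma iso_isoT n (G H : sgraph n) : iso G H <-> isoT (adj G) (adj H).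
Proof.
split=> [[f [fb fe]]|[f [fI _ fe]]].
  exists f; apply: isoOn_mk => [x y _ _|x _||x y _ _]; rewrite ?in_setT //.
  exact: (bij_inj fb).
exists f; split; first by apply: injF_bij => x y; apply: fI; rewrite in_setT.
by move=> x y; apply: fe; rewrite in_setT.
Qed.

Lemma isoOn_lift n (G : sgraph n.+1) v :
  isoOn (adj (card_del G v)) (adj G) setT [set~ v] (lift v).
Proof.
apply: isoOn_mk => //.
- by move=> x y _ _; apply: lift_inj.
- by move=> x _; rewrite !inE eq_sym neq_lift.
- by rewrite cardsC1 cardsT !card_ord.
Qed.

Lemma iso_card_del n (G H : sgraph n.+1) v w : 0 < n ->
  iso (card_del G v) (card_del H w) <->
  exists f, isoOn (adj G) (adj H) [set~ v] [set~ w] f.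
Proof.
case: n G H v w => // n G H v w _.
have vi := isoOn_lift G v; have wi := isoOn_lift H w.
have [v' [vi' _ _]] := isoOn_inv ord0 vi; have [w' [wi' _ _]] := isoOn_inv ord0 wi.
rewrite iso_isoT; split=> -[f fi].
  by exists (lift w \o (f \o v')); apply: isoOn_comp wi; apply: isoOn_comp fi.
by exists (w' \o (f \o lift v)); apply: isoOn_comp wi'; apply: isoOn_comp fi.
Qed.

Lemma same_deckP n (G H : sgraph n.+1) : 0 < n ->
  same_deck G H <-> exists s, deck_by (adj G) (adj H) s.
Proof.
move=> n0; split=> [[s [sb sd]]|[s [sI sd]]]; exists s.
  by split=> [|v]; [apply: bij_inj|apply/iso_card_del].
by split=> [|v]; [apply: injF_bij|apply/iso_card_del].
Qed.

(** * Two-connectedness, domination and diameter in terms of cuts *)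

Lemma connect_nondisc (T : finType) (e : rel T) u v :
  ~~ disc e setT -> connect e u v.
Proof.
move=> nd; apply: contraT => nuv.
have [x [y [_ + _ + xy]]] := conn_cut (S := [set w | connect e u w]) (x := u) (y := v)
  nd (in_setT u) ltac:(by rewrite inE) (in_setT v) ltac:(by rewrite inE).
by rewrite !inE => ux; rewrite (connect_trans ux (connect1 xy)).
Qed.

Lemma two_connectedI n (G : sgraph n.+1) : 2 <= n -> ~~ disc (adj G) setT ->
  (forall v, ~~ disc (adj G) [set~ v]) -> two_connected G.
Proof.
move=> n2 nd ndv; split=> //; split=> [u v|w u v]; apply: connect_nondisc => //.
have [g [gi _ _]] := isoOn_inv u (isoOn_lift G w).
by apply: contra (ndv w); apply: isoOn_disc gi.
Qed.

Lemma bigminn_le (I : eqType) (r : seq I) (P : pred I) F m j :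
  j \in r -> P j -> \big[minn/m]_(i <- r | P i) F i <= F j.
Proof.
elim: r => // a r IH; rewrite inE big_cons => /orP[/eqP<- ->|jr Pj].
  exact: geq_minl.
by case: ifP => _; [apply: leq_trans (geq_minr _ _) _|]; apply: IH.
Qed.

Lemma domination_number2 n (G : sgraph n.+1) : 0 < n ->
  ~~ disc (co (adj G)) setT -> dominating_pair (adj G) setT -> domination_number G = 2.
Proof.
move=> n0 nd [a [b [_ _ ab]]]; apply/eqP; rewrite eqn_leq; apply/andP; split.
  apply: (@leq_trans #|[set a; b]|); last by rewrite cards2; case: (_ != _).
  apply: bigminn_le; first by rewrite mem_index_enum.
  apply/forallP=> v; have := ab v (in_setT v); rewrite !inE.
  case/or4P=> [->|->|H|H]; rewrite ?orbT //; apply/orP; right; apply/existsP.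
    by exists a; rewrite !inE eqxx.
  by exists b; rewrite !inE eqxx orbT.
(* The default value of the minimum is the number of vertices [n.+1], which is at least two. *)
apply: (big_ind (fun x => 1 < x)) => // [x y|D /forallP Dd]; first by rewrite leq_min => -> ->.
rewrite ltnNge; apply/negP=> D1.
have [u uD] : exists u, u \in D.
  by have := Dd ord0; case/orP=> [|/existsP[u /andP[]]]; [exists ord0|exists u].
have Du : D = [set u].
  by apply/esym/eqP; rewrite eqEcard sub1set uD cards1.
have [v uv] : exists v, u != v.
  have /card_gt0P[v] : 0 < #|[set~ u]| by rewrite cardsC1 card_ord.
  by rewrite !inE => vu; exists v; rewrite eq_sym.
have [w] := disc_setT_nbr (simple_co (simple_adj G)).1 nd uv.
case/andP=> uw; have := Dd w; rewrite Du inE eq_sym (negPf uw) /=.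
by case/existsP=> u'; rewrite inE => /andP[/eqP-> ->].
Qed.

Lemma walkb0 n (G : sgraph n) u v : walkb G 0 u v = (u == v).
Proof.
apply/existsP/eqP => [[s]|->]; first by rewrite (tuple0 s) => /andP[_ /eqP].
by exists [tuple]; rewrite /=.
Qed.

Lemma walkb1 n (G : sgraph n) u v : adj G u v -> walkb G 1 u v.
Proof. by move=> uv; apply/existsP; exists [tuple v]; rewrite /= uv eqxx. Qed.

Lemma walkb1E n (G : sgraph n) u v : walkb G 1 u v -> adj G u v.
Proof.
case/existsP=> -[[|w [|]] //= i]; rewrite andbT.
by case/andP=> uw /eqP<-.
Qed.

Lemma walkb2 n (G : sgraph n) u v w : adj G u w -> adj G w v -> walkb G 2 u v.
Proof. by move=> uw wv; apply/existsP; exists [tuple w; v]; rewrite /= uw wv eqxx. Qed.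

Lemma diam2 n (G : sgraph n.+1) : 2 <= n ->
    (forall u v, u != v -> ~~ adj G u v -> exists w, adj G u w && adj G w v) ->
    (exists u v, u != v /\ ~~ adj G u v) ->
  diam G = Some 2.
Proof.
(* At least three vertices put the length [2] within the range searched by [dist]. *)
case: n G => [|[|n]] // G _ near [a [b [ab nab]]].
have dE u v : dist G u v = if u == v then Some 0 else if adj G u v then Some 1 else Some 2.
  rewrite /dist /= walkb0; have [//|uv] := eqVneq u v.
  have [/walkb1->//|nuv] := boolP (adj G u v).
  have [/walkb1E uv1|_] := boolP (walkb G 1 u v); first by rewrite uv1 in nuv.
  by have [w /andP[uw wv]] := near u v uv nuv; rewrite (walkb2 uw wv).
rewrite /diam ifT; last by apply/forallP=> u; apply/forallP=> v; rewrite dE; case: ifP => // _; case: ifP.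
congr Some; apply/eqP; rewrite eqn_leq; apply/andP; split.
  apply/bigmax_leqP=> u _; apply/bigmax_leqP=> v _.
  by rewrite dE; case: ifP => // _; case: ifP.
apply: leq_trans (leq_bigmax a); apply: leq_trans (leq_bigmax b).
by rewrite dE (negPf ab) (negPf nab).
Qed.

Lemma isoT_co (T : finType) (e e' : rel T) : simple e -> simple e' ->
  isoT (co e) (co e') -> isoT e e'.
Proof.
move=> eG eG' [f /isoOn_co[fI fB fe]]; exists f; split=> // x y xT yT.
by rewrite -(coK eG) -(coK eG') fe.
Qed.

(** If the complement is disconnected, it is reconstructed instead. Otherwise no vertex dominates
    alone, since it would be isolated in the complement, and the domination number is exactly
    two. *)
Lemma two_conn_recon n (e e' : rel 'I_n.+1) s : two_conn_hyp -> 2 <= n ->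
    simple e -> simple e' -> deck_by e e' s ->
    ~~ disc e setT -> (forall v, ~~ disc e [set~ v]) -> dominating_pair e setT ->
  isoT e e'.
Proof.
move=> HA n2 eG eG' sd nd ndv dp.
have cT : 2 < #|'I_n.+1| by rewrite card_ord.
have [dco|ndco] := boolP (disc (co e) setT).
  apply: isoT_co => //.
  exact: disc_recon (simple_co eG) (simple_co eG') cT (deck_co sd) dco.
have n0 : 0 < n by apply: leq_trans n2.
apply/(iso_isoT (mk_sgraph eG) (mk_sgraph eG')); apply: HA.
- exact: two_connectedI.
- by left; apply: domination_number2.
- by apply/same_deckP => //; exists s.
Qed.

Lemma ord_param (U : finType) (V : {set U}) n : #|V| = n ->
  exists b : 'I_n -> U, injective b /\ b @: setT = V.
Proof.
move=> <-; exists (fun i => enum_val i); split; first exact: enum_val_inj.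
apply/setP=> x; apply/imsetP/idP => [[i _ ->]|xV]; first exact: enum_valP.
by exists (enum_rank_in xV x); rewrite ?enum_rankK_in.
Qed.

Lemma set_recon : two_conn_hyp -> set_recon_hyp.
Proof.
move=> HA U r r' V V' s rG rG' cV sI sV cards nd ndv [a [b [aV bV ab]]].
have [n nE] : exists n, #|V| = n.+1 by case: #|V| cV => // n; exists n.
have n2 : 2 <= n by rewrite nE in cV.
have cV' : #|V'| = n.+1 by rewrite -sV card_in_imset.
have par (q : rel U) (W : {set U}) : simple q -> #|W| = n.+1 -> exists (h : 'I_n.+1 -> U) (q' : rel 'I_n.+1),
    simple q' /\ isoOn q' q setT W h.
  move=> [qS qI] /ord_param[h [hI hW]]; exists h, (relpre h q); split.
    by split=> x /=; [move=> y; apply: qS|apply: qI].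
  by split=> // x y _ _; apply: hI.
have [h [e [eG hi]]] := par r V rG nE; have [h' [e' [eG' hi']]] := par r' V' rG' cV'.
have [k [ki hK kK]] := isoOn_inv ord0 hi.
have [k' [ki' hK' kK']] := isoOn_inv ord0 hi'.
have hV x : h x \in V by apply: isoOn_mem hi (in_setT x).
have sV' x : x \in V -> s x \in V' by rewrite -sV; apply: imset_f.
have hdel x : isoOn e r [set~ x] (V :\ h x) h.
  by have := isoOn_del hi (in_setT x); rewrite setTD.
have [f fi] : isoT e e'.
  apply: (two_conn_recon (s := fun x => k' (s (h x))) HA) => //.
  - split=> [x y /(can_in_inj kK') E|x].
      have := sI _ _ (hV x) (hV y) (E (sV' _ (hV x)) (sV' _ (hV y))).
      by have [hI _ _] := hi; apply: hI; rewrite in_setT.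
    have [f fi] := cards _ (hV x); exists (k' \o (f \o h)).
    have := isoOn_del ki' (sV' _ (hV x)); rewrite setTD => kd.
    by apply: isoOn_comp kd; apply: isoOn_comp (hdel x) fi.
  - by apply: contra nd; apply: isoOn_disc ki.
  - move=> x; apply: contra (ndv _ (hV x)).
    have := isoOn_del ki (hV x); rewrite hK ?in_setT // setTD.
    exact: isoOn_disc.
  - exists (k a), (k b); split; rewrite ?in_setT // => x _.
    have [kI _ ke] := ki; have := ab _ (hV x).
    by rewrite -(inj_in_eq kI) // -[X in _ || (X || _)](inj_in_eq kI) // -!ke // hK ?in_setT.
exists (h' \o (f \o k)); apply: isoOn_comp hi'; exact: isoOn_comp ki fi.
Qed.

(** * Cutvertices and complements *)

Lemma disc_co_conn (T : finType) (e : rel T) A : simple e -> disc e A -> ~~ disc (co e) A.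
Proof.
move=> eG /disc_elim[S [x [y [/subsetP sSA xS /setDP[yA yS] cl]]]].
have [cS _] := simple_co eG.
have adjS u v : u \in S -> v \in A -> v \notin S -> co e u v.
  move=> uS vA vS; rewrite /co cl // andbT.
  by apply: contraNneq vS => <-.
apply: (conn_hub (h := x)) => //; first exact: sSA.
move=> u uA; have [uS|uS] := boolP (u \in S); last by constructor 2; apply: adjS.
by constructor 3; exists y; split=> //; [|rewrite cS]; apply: adjS.
Qed.

(** In the complement, a neighbour [x] of [c] dominates [c] and the side of the cut away from [x],
    and a vertex [y] on that side dominates the side of [x]. *)
Lemma cutvertex_dominating (T : finType) (e : rel T) c : simple e ->
  disc e [set~ c] -> ~~ disc (co e) setT -> dominating_pair (co e) setT.
Proof.
move=> eG dc nd; have [eS eI] := eG; have [cS cI] := simple_co eG.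
have [S0 [a0 [a [_ _ /setDP[aA _] _]]]] := disc_elim dc.
have ca : c != a by move: aA; rewrite !inE eq_sym.
have [x cx] := disc_setT_nbr cS nd ca.
have xA : x \in [set~ c] by rewrite !inE; apply: contraTneq cx => ->; rewrite cI.
have [S [y [sS xS yA yS cl]]] := disc_at eS dc xA.
exists x, y; split; rewrite ?in_setT // => u _.
have [->|uc] := eqVneq u c; first by rewrite [co e x c]cS cx !orbT.
have uA : u \in [set~ c] by rewrite !inE.
have [uS|uS] := boolP (u \in S).
  have yu : e y u = false by rewrite eS cl.
  by rewrite /co yu (eq_sym y); case: (u == y); rewrite !orbT.
by rewrite /co cl // (eq_sym x); case: (u == x); rewrite ?orbT.
Qed.

(** The side of [c] in the cut at [d] decides. If it has another vertex, [co e] stays connected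
    without [c] and [d], so in [co e] the only neighbour of [d] is [c]. Otherwise the only neighbour
    of [c] in [e] is [d]. *)
Lemma both_cut_hinge (T : finType) (e : rel T) d c : simple e ->
    ~~ disc e setT -> ~~ disc (co e) setT -> disc e [set~ d] -> disc (co e) [set~ c] ->
  misses_only e setT d c \/ misses_only (co e) setT c d.
Proof.
move=> eG nd ndc dd dc; have [eS eI] := eG; have [cS cI] := simple_co eG.
have cd : c != d.
  by apply: contraTneq dc => ->; apply: disc_co_conn.
have dcn : d != c by rewrite eq_sym.
have cA : c \in [set~ d] by rewrite !inE.
have [S [b [/subsetP sS cinS bA bS cl]]] := disc_at eS dd cA.
have bc : b != c by apply: contraNneq bS => ->.
case: (boolP [exists c2 in S, c2 != c]) => [/exists_inP[c2 c2S c2c]|/exists_inPn only].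
  left; have adjS u v : u \in S -> v \in [set~ d] -> v \notin S -> co e u v.
    move=> uS vA vS; rewrite /co cl // andbT.
    by apply: contraNneq vS => <-.
  have nW : ~~ disc (co e) ([set~ c] :\ d).
    apply: (conn_hub (h := c2)) => //.
      by have := sS _ c2S; rewrite !inE c2c => ->.
    move=> u uW; have uA : u \in [set~ d] by move: uW; rewrite !inE => /andP[].
    have [uS|uS] := boolP (u \in S); last by constructor 2; apply: adjS.
    constructor 3; exists b; split; first by move: bA; rewrite !inE bc => ->.
      exact: adjS.
    by rewrite cS; apply: adjS.
  have dX : d \in [set~ c] by rewrite !inE.
  have iso := disc_del_isolated cS cI dX dc nW.
  have [w dw] := disc_setT_nbr cS ndc dcn.
  have wc : w = c.
    by apply/eqP; apply: contraT => wc; rewrite iso ?inE // in dw.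
  rewrite wc in dw; split; rewrite ?in_setT // => u _.
  have [->|uc] := eqVneq u c; first by case/andP: dw => _ /negPf->; rewrite andbF.
  have := iso u; rewrite !inE uc => /(_ isT).
  rewrite /co eq_sym andbT; have [->|_] /= := eqVneq u d; first by rewrite eI.
  by move/negbFE.
right; have onlyc u : u \in [set~ d] -> e c u = false.
  move=> uA; have [uS|uS] := boolP (u \in S); last exact: cl.
  by have := only u uS; rewrite negbK => /eqP->.
have [w cw] := disc_setT_nbr eS nd cd.
have wd : w = d by apply/eqP; apply: contraT => wd; rewrite onlyc ?inE // in cw.
rewrite wd in cw; split; rewrite ?in_setT // => u _.
rewrite /co eq_sym; have [->|ud] := eqVneq u d; first by rewrite cw andbF.
by rewrite onlyc ?inE.
Qed.

Lemma dominating_pair_eq2 (T : finType) (e e' : rel T) A :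
  e =2 e' -> dominating_pair e A -> dominating_pair e' A.
Proof. by move=> ee [a [b [aA bA H]]]; exists a, b; split=> // x xA; rewrite -!ee H. Qed.

Lemma disc_eq2 (T : finType) (e e' : rel T) A : e =2 e' -> disc e A = disc e' A.
Proof.
move=> ee; apply: eq_existsb => S; congr [&& _, _ & _].
by apply: eq_forallb => x; congr (_ ==> _); apply: eq_forallb => y; rewrite ee.
Qed.

(** A vertex that a nonadjacent pair fails to dominate in the complement is a common neighbour of
    the pair. So without dominating pairs on either side, distances are at most two in both graphs,
    and connectedness of each complement provides a nonadjacent pair. *)
Lemma two_conn_both n (e e' : rel 'I_n.+1) s : two_conn_hyp -> 2 <= n ->
    simple e -> simple e' -> deck_by e e' s ->
    ~~ disc e setT -> ~~ disc (co e) setT ->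
    (forall v, ~~ disc e [set~ v]) -> (forall v, ~~ disc (co e) [set~ v]) ->
  isoT e e'.
Proof.
move=> HA n2 eG eG' sd nd ndc ndv ndcv.
pose pairb (r : rel 'I_n.+1) := [exists a, exists b, forall x, [|| x == a, x == b, r a x | r b x]].
have pairP (r : rel 'I_n.+1) : pairb r -> dominating_pair r setT.
  by case/existsP=> a /existsP[b /forallP H]; exists a, b; split.
have [/pairP dp|np] := boolP (pairb e); first exact: (two_conn_recon HA n2 eG eG' sd).
have [/pairP dp|npc] := boolP (pairb (co e)).
  apply: isoT_co => //.
  exact: (two_conn_recon HA n2 (simple_co eG) (simple_co eG') (deck_co sd)).
have n0 : 0 < n by apply: leq_trans n2.
have far (r q : rel 'I_n.+1) : simple r -> simple q -> q =2 co r -> ~~ pairb q ->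
    forall u v, u != v -> ~~ r u v -> exists w, r u w && r w v.
  move=> [rS rI] [qS _] qr /existsPn npq u v uv nuv.
  have /existsPn/(_ v)/forallPn[w] := npq u.
  rewrite !negb_or !qr /co => /and4P[wu wv].
  rewrite eq_sym wu eq_sym wv /= !negbK => uw vw.
  by exists w; rewrite uw rS.
have exn (r : rel 'I_n.+1) : symmetric r -> ~~ disc (co r) setT -> exists u v, u != v /\ ~~ r u v.
  move=> rS; have /card_gt1P[u [v [_ _ uv]]] : 1 < #|'I_n.+1| by rewrite card_ord.
  have cS : symmetric (co r) by move=> x y; rewrite /co eq_sym rS.
  move=> ndr; have [w /andP[uw nuw]] := disc_setT_nbr cS ndr uv.
  by exists u, w.
have cG := simple_co eG.
have coKe x y : e x y = co (co e) x y by rewrite coK.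
apply/(iso_isoT (mk_sgraph eG) (mk_sgraph eG')); apply: HA.
- exact: two_connectedI.
- right; split; apply: diam2 => //=.
  + exact: far npc.
  + exact: exn eG.1 ndc.
  + exact: (far _ _ cG eG coKe np).
  + by apply: (exn _ cG.1); rewrite -(disc_eq2 _ coKe).
- by apply/same_deckP => //; exists s.
Qed.

Lemma recon n (e e' : rel 'I_n.+1) s : two_conn_hyp -> 2 <= n ->
  simple e -> simple e' -> deck_by e e' s -> isoT e e'.
Proof.
move=> HA n2 eG eG' sd.
have cT : 2 < #|'I_n.+1| by rewrite card_ord.
have cG := simple_co eG; have cG' := simple_co eG'; have csd := deck_co sd.
have HS := set_recon HA.
have [d|nd] := boolP (disc e setT); first exact: (disc_recon eG eG' cT sd d).
have [d|ndc] := boolP (disc (co e) setT).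
  exact: (isoT_co eG eG' (disc_recon cG cG' cT csd d)).
have ndcc : ~~ disc (co (co e)) setT by rewrite (disc_eq2 _ (coK eG)).
have [/existsP[d dd]|/existsPn ncut] := boolP [exists v, disc e [set~ v]];
  have [/existsP[c dc]|/existsPn nccut] := boolP [exists v, disc (co e) [set~ v]].
- case: (both_cut_hinge eG nd ndc dd dc) => mo.
    exact: (hinge_recon HS eG eG' cT sd mo nd dd).
  exact: (isoT_co eG eG' (hinge_recon HS cG cG' cT csd mo ndc dc)).
- apply: (isoT_co eG eG'); apply: (two_conn_recon HA n2 cG cG' csd) => //.
  exact: cutvertex_dominating dd ndc.
- apply: (two_conn_recon HA n2 eG eG' sd) => //.
  exact: dominating_pair_eq2 (coK eG) (cutvertex_dominating cG dc ndcc).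
- exact: two_conn_both sd _ _ _ _.
Qed.

Theorem theorem7 :
  (forall n (G : sgraph n.+1), 2 <= n -> reconstructible G) <->
  (forall n (G : sgraph n.+1), two_connected G ->
     (domination_number G = 2 \/ (diam G = Some 2 /\ diam (compl G) = Some 2)) ->
     reconstructible G).
Proof.
split=> [all n G [n2 _] _|HA n G n2 H]; first exact: all.
case/same_deckP; first exact: leq_trans n2.
move=> s sd; apply/iso_isoT.
exact: recon HA n2 (simple_adj G) (simple_adj H) sd.
Qed.
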